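(* $$\sum_{i=1}^{\infty } \frac{\sum_{j=1}^i \frac{1}{j^3}}{i^2 \binom{2 i}{i}}= \frac{\zeta_5}{9}+\frac{\pi ^2 \zeta_3}{27}.$$
   Context: $\zeta_n:=\sum_{i=1}^\infty \frac{1}{i^n}$ for integers $n\ge 2$; $\binom{2i}{i}$ is the central binomial coefficient. *)

(* Defs.v *)
From Stdlib Require Import Reals.
From Coquelicot Require Import Coquelicot.

Open Scope R_scope.

(* [Series] is indexed from 0, so the summation index i >= 1 is S k.
   The series converges exactly for n >= 2, the only range where [zeta] is meant
   to be used. *)
Definition zeta (n : nat) : R := Series (fun k : nat => 1 / INR (S k) ^ n).

(* [Binomial.C] is qualified because Coquelicot uses [C] for the complex numbers. *)
Definition central_binomial (i : nat) : R := Binomial.C (2 * i) i.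

(* Main.v *)
Require Import Defs.
From Stdlib Require Import Arith Reals Lra Lia.
From Coquelicot Require Import Coquelicot.

Open Scope R_scope.

(** The proof finds a function of x on (0, pi/3), [firstIntegral], which is constant, and compares
    its limits at the two ends.  Write t = 2 - 2 cos x = |1 - e^(ix)|^2, L = log |1 - e^(ix)|,
    s = (pi - x)/2, so that t = 1 and L = 0 at x = pi/3.

    The sum of the theorem is the value at x = pi/3 of A_3 + G, where A_k is the sum of
    t^n / (n^(k+2) C(2n,n)) and G is the sum of H t^n / (n^2 C(2n,n)), with H the sum of 1/j^3
    over j < n.  Since the second derivative of t^n in x is 2n(2n-1) t^(n-1) - n^2 t^n, a series with
    these central binomial weights has as second derivative a series in the differences of its
    coefficients ([is_derive_cbSeries']).  Hence A_0 = x^2/2 and G'' = A_1, while A_k' = 2 L' A_(k-1).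
    Repeated integration by parts would therefore express A_3 by twice the integral of
    x^2 L^2 dL over (0, pi/3), and G by half the integral of x^2 (pi/3 - x)^2 dL.

    The integral of x^2 L^2 dL is found by moving a contour.  Let P be the primitive of
    log(z)^2 log(1 - z)^2 dz/z given by integrating the power series of log(1 - z)^2 term by term.
    On the circle |1 - z| = 1, with z = 1 - e^(-ix), one has log(1 - z) = - ix and
    log z = L + is, so that the derivative of Re P is - x^2 ((L^2 - s^2) L' + L s)
    ([is_derive_circleSeries]).  On the circle |z| = 1, with z = e^(ix), one has log z = ix and
    log(1 - z) = L - is, so that the derivative of Re P is - 2 x^2 L s ([is_derive_arcSeries]).  The first
    arc joins 0 to the sixth root of unity and the second joins 1 to it, where the two values of
    Re P agree; at z = 0 it vanishes, and at z = 1 it is 4 zeta(4,1), which Euler's finite identity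
    [euler_finite] evaluates.

    What remains is linear in L: it is a multiple of the integral of x (pi - 3x)(2 pi - 3x) L,
    whose primitive [logPrimitive] is a combination of the series of sin(nx)/n^k and cos(nx)/n^k.  The cubic
    vanishes at 0 and pi/3 and is odd about pi/3, so that only cosine series of weights 3 and 5
    survive at the ends, and these are rational multiples of zeta(3) and zeta(5) at pi/3. *)

(** * Passing to the limit in series *)

Lemma ex_series_dominated (a M : nat -> R) :
  (forall n, Rabs (a n) <= M n) -> ex_series M -> ex_series a.
Proof. intros H HM; apply (ex_series_le (V := R_CompleteNormedModule) a M); auto. Qed.

Lemma Series_Rabs_le (a M : nat -> R) :
  (forall n, Rabs (a n) <= M n) -> ex_series M -> Rabs (Series a) <= Series M.
Proof.
  intros H HM.
  eapply Rle_trans; [apply Series_Rabs|].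
  - apply (ex_series_dominated _ M); auto. intros n; rewrite Rabs_Rabsolu; auto.
  - apply Series_le; auto. intros n; split; [apply Rabs_pos|auto].
Qed.

Lemma filterlim_Rplus {T : Type} {F : (T -> Prop) -> Prop} {FF : Filter F}
  (f g : T -> R) (a b : R) :
  filterlim f F (locally a) -> filterlim g F (locally b) ->
  filterlim (fun x => f x + g x) F (locally (a + b)).
Proof.
  intros Hf Hg. eapply filterlim_comp_2; [exact Hf|exact Hg|].
  apply (filterlim_plus (V := R_NormedModule)).
Qed.

Lemma filterlim_Rmult {T : Type} {F : (T -> Prop) -> Prop} {FF : Filter F}
  (f g : T -> R) (a b : R) :
  filterlim f F (locally a) -> filterlim g F (locally b) ->
  filterlim (fun x => f x * g x) F (locally (a * b)).
Proof.
  intros Hf Hg. eapply filterlim_comp_2; [exact Hf|exact Hg|].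
  apply (filterlim_mult (K := R_AbsRing)).
Qed.

Lemma filterlim_Rminus {T : Type} {F : (T -> Prop) -> Prop} {FF : Filter F}
  (f g : T -> R) (a b : R) :
  filterlim f F (locally a) -> filterlim g F (locally b) ->
  filterlim (fun x => f x - g x) F (locally (a - b)).
Proof.
  intros Hf Hg. apply filterlim_Rplus; [exact Hf|].
  eapply filterlim_comp; [exact Hg|apply (filterlim_opp (V := R_NormedModule))].
Qed.

Lemma filterlim_sum_n {T : Type} {F : (T -> Prop) -> Prop} {FF : Filter F}
  (f : nat -> T -> R) (l : nat -> R) (N : nat) :
  (forall n, filterlim (f n) F (locally (l n))) ->
  filterlim (fun x => sum_n (fun n => f n x) N) F (locally (sum_n l N)).
Proof.
  intros H; induction N as [|N IH].
  - rewrite sum_O. apply filterlim_ext with (f 0%nat); auto.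
    intros x; now rewrite sum_O.
  - rewrite sum_Sn.
    apply filterlim_ext with (fun x => plus (sum_n (fun n => f n x) N) (f (S N) x)).
    { intros x; now rewrite sum_Sn. }
    apply filterlim_Rplus; auto.
Qed.

Lemma Series_tail_small (M : nat -> R) (eps : posreal) :
  ex_series M -> exists N, Rabs (Series (fun n => M (S N + n)%nat)) < eps.
Proof.
  intros HM.
  pose proof (Series_correct _ HM) as HS.
  apply is_series_Reals in HS.
  destruct (HS eps (cond_pos eps)) as [N HN].
  exists N. specialize (HN N (le_n N)).
  rewrite (Series_incr_n M (S N)) in HN by (try lia; auto).
  unfold Rdist in HN. simpl pred in HN.
  rewrite Rabs_minus_sym in HN.
  match type of HN with Rabs ?e < _ => replace e with (Series (fun n => M (S N + n)%nat)) in HN by ring end.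
  exact HN.
Qed.

(** Tannery's theorem: the tails are uniformly small, and the heads are finite sums. *)
Lemma filterlim_Series {T : Type} {F : (T -> Prop) -> Prop} {FF : ProperFilter F}
  (f : nat -> T -> R) (l M : nat -> R) :
  ex_series M ->
  F (fun x => forall n, Rabs (f n x) <= M n) ->
  (forall n, filterlim (f n) F (locally (l n))) ->
  filterlim (fun x => Series (fun n => f n x)) F (locally (Series l)).
Proof.
  intros HM Hb Hl.
  assert (Hlb : forall n, Rabs (l n) <= M n).
  { intros n.
    apply (filterlim_le (F := F) (fun x => Rabs (f n x)) (fun _ => M n) (Rabs (l n)) (M n)).
    - revert Hb; apply filter_imp; auto.
    - eapply filterlim_comp; [apply Hl|]. apply (continuous_Rabs (l n)).
    - apply filterlim_const. }
  apply filterlim_locally; intros eps.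
  destruct (Series_tail_small M (pos_div_2 (pos_div_2 eps)) HM) as [N HN].
  pose proof (filterlim_sum_n f l N Hl) as Hs.
  pose proof (proj1 (filterlim_locally _ _) Hs (pos_div_2 eps)) as Hs'.
  generalize (filter_and _ _ Hb Hs'); apply filter_imp; intros x [H1 H2].
  change (Rabs (sum_n (fun n => f n x) N - sum_n l N) < eps / 2) in H2.
  change (Rabs (Series (fun n => f n x) - Series l) < eps).
  rewrite (Series_incr_n (fun n => f n x) (S N)), (Series_incr_n l (S N));
    try lia; try (eapply ex_series_dominated; eauto).
  simpl pred.
  rewrite <- !sum_n_Reals.
  assert (HMt : ex_series (fun n => M (S N + n)%nat)) by (apply -> (ex_series_incr_n M (S N)); auto).
  assert (Ha : Rabs (Series (fun n => f (S N + n)%nat x)) <= Series (fun n => M (S N + n)%nat))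
    by (apply Series_Rabs_le; auto).
  assert (Hc : Rabs (Series (fun n => l (S N + n)%nat)) <= Series (fun n => M (S N + n)%nat))
    by (apply Series_Rabs_le; auto).
  simpl pos in HN. pose proof (Rle_abs (Series (fun n => M (S N + n)%nat))).
  apply Rabs_def2 in H2. apply Rabs_le_between in Ha, Hc.
  apply Rabs_def1; lra.
Qed.

Lemma is_derive_slope (f : R -> R) (x l : R) :
  filterlim (fun y => (f y - f x) / (y - x)) (locally' x) (locally l) -> is_derive f x l.
Proof.
  intros H. apply is_derive_Reals. intros eps Heps.
  destruct (proj1 (filterlim_locally _ _) H (mkposreal eps Heps)) as [d Hd].
  exists d. intros h Hh Hlt.
  specialize (Hd (x + h)).
  assert (Hb : ball x d (x + h)).
  { change (Rabs (x + h - x) < d). now replace (x + h - x) with h by ring. }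
  specialize (Hd Hb).
  assert (x + h <> x) by lra. specialize (Hd H0).
  change (Rabs ((f (x + h) - f x) / (x + h - x) - l) < eps) in Hd.
  now replace (x + h - x) with h in Hd by ring.
Qed.

(** The mean value theorem on a neighbourhood chosen before the function, so that it applies to all
    the terms of a series at once. *)
Lemma MVT_locally (P : R -> Prop) (x : R) :
  locally x P ->
  locally x (fun y => forall f df : R -> R,
     (forall z, P z -> is_derive f z (df z)) ->
     exists c, P c /\ Rabs (c - x) <= Rabs (y - x) /\ f y - f x = df c * (y - x)).
Proof.
  intros [d Hd]. exists d. intros y Hy f df Hf.
  change (Rabs (y - x) < d) in Hy.
  assert (Hin : forall z, Rmin x y <= z <= Rmax x y -> Rabs (z - x) <= Rabs (y - x)).
  { intros z. unfold Rmin, Rmax. destruct (Rle_dec x y); intros;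
      unfold Rabs; destruct (Rcase_abs (z - x)), (Rcase_abs (y - x)); lra. }
  assert (HP : forall z, Rmin x y <= z <= Rmax x y -> P z).
  { intros z Hz. apply Hd. change (Rabs (z - x) < d). pose proof (Hin z Hz). lra. }
  destruct (MVT_gen f x y df) as [c [Hc He]].
  - intros z Hz. apply Hf, HP. lra.
  - intros z Hz. apply derivable_continuous_pt. exists (df z).
    apply is_derive_Reals, Hf, HP, Hz.
  - exists c. auto.
Qed.

(** Termwise differentiation: Tannery's theorem applied to difference quotients, which the
    mean value theorem bounds by the same majorant as the derivatives. *)
Lemma is_derive_Series (f f' : nat -> R -> R) (M : nat -> R) (x : R) :
  ex_series M ->
  locally x (fun y => forall n, is_derive (f n) y (f' n y) /\ Rabs (f' n y) <= M n) ->
  locally x (fun y => ex_series (fun n => f n y)) ->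
  is_derive (fun y => Series (fun n => f n y)) x (Series (fun n => f' n x)).
Proof.
  intros HM Hd Hex.
  apply is_derive_slope.
  apply filterlim_ext_loc with (fun y => Series (fun n => (f n y - f n x) / (y - x))).
  { unfold locally', within. pose proof (locally_singleton _ _ Hex) as Hx.
    revert Hex; apply filter_imp; intros y Hy Hne.
    rewrite <- Series_minus by assumption.
    unfold Rdiv. rewrite <- Series_scal_r. reflexivity. }
  apply (filterlim_Series (FF := Rbar_locally'_filter (Finite x)) _ _ M); auto.
  - change (locally x (fun y => y <> x -> forall n, Rabs ((f n y - f n x) / (y - x)) <= M n)).
    generalize (MVT_locally _ _ Hd); apply filter_imp; intros y Hy Hne n.
    destruct (Hy (f n) (f' n)) as [c [Hc [_ He]]]; [intros z Hz; apply Hz|].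
    rewrite He. replace (f' n c * (y - x) / (y - x)) with (f' n c) by (field; lra).
    apply Hc.
  - intros n. destruct (locally_singleton _ _ Hd n) as [Hn _].
    apply is_derive_Reals in Hn.
    apply filterlim_locally; intros eps.
    destruct (Hn eps (cond_pos eps)) as [d Hdl].
    exists d. intros y Hy Hne. change (Rabs (y - x) < d) in Hy.
    specialize (Hdl (y - x)). rewrite (Rplus_minus x y) in Hdl.
    apply Hdl; [|exact Hy]. intros H0; apply Hne, Rminus_diag_uniq, H0.
Qed.

(** Recovers derivatives of Fourier series on the unit circle, where termwise differentiation is
    illegitimate, from the disk r < 1; joint convergence of the derivatives makes the mean value
    theorem pass to the limit. *)
Lemma is_derive_radial_limit (F f : R -> R -> R) (F1 : R -> R) (x l : R) :
  locally x (fun y => forall r, 0 < r < 1 -> is_derive (F r) y (f r y)) ->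
  filterlim (fun p => f (fst p) (snd p)) (filter_prod (at_left 1) (locally x)) (locally l) ->
  locally x (fun y => filterlim (fun r => F r y) (at_left 1) (locally (F1 y))) ->
  is_derive F1 x l.
Proof.
  intros Hd Hf HF. apply is_derive_slope.
  apply filterlim_locally; intros eps.
  pose proof (proj1 (filterlim_locally _ _) Hf (pos_div_2 eps)) as He.
  destruct He as [Q P HQ HP HQP]. simpl in HQP.
  pose proof (locally_singleton _ _ HF) as HFx.
  change (locally x (fun y => y <> x -> ball l eps ((F1 y - F1 x) / (y - x)))).
  generalize (filter_and _ _ HF (MVT_locally _ _ (filter_and _ _ HP Hd))).
  apply filter_imp; intros y [Hy Hm] Hne.
  change (Rabs ((F1 y - F1 x) / (y - x) - l) < eps).
  apply Rle_lt_trans with (eps / 2); [|pose proof (cond_pos eps); lra].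
  apply (filterlim_le (F := at_left 1)
     (fun r => Rabs ((F r y - F r x) / (y - x) - l)) (fun _ => eps / 2)
     (Rabs ((F1 y - F1 x) / (y - x) - l)) (eps / 2)).
  - assert (H01 : at_left 1 (fun r => 0 < r < 1)).
    { exists (mkposreal 1 Rlt_0_1). intros r Hr Hr1. change (Rabs (r - 1) < 1) in Hr.
      apply Rabs_def2 in Hr. lra. }
    generalize (filter_and _ _ HQ H01). apply filter_imp; intros r [Hr Hr1].
    destruct (Hm (F r) (f r)) as [c [[Hc1 Hc2] [_ Hc3]]].
    { intros z [_ Hz]; auto. }
    rewrite Hc3. replace (f r c * (y - x) / (y - x)) with (f r c) by (field; lra).
    specialize (HQP r c Hr Hc1). left. exact HQP.
  - apply (filterlim_comp _ _ _ (fun r => (F r y - F r x) / (y - x) - l) Rabs _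
             (locally ((F1 y - F1 x) / (y - x) - l))); [|apply continuous_Rabs].
    apply filterlim_Rminus; [|apply filterlim_const].
    apply filterlim_Rmult; [|apply filterlim_const].
    apply filterlim_Rminus; assumption.
  - apply filterlim_const.
Qed.

(** * The logarithm on the unit disk *)

Lemma CV_radius_gt (a : nat -> R) (K rho x : R) :
  (forall n, Rabs (a n * rho ^ n) <= K) -> Rabs x < rho -> Rbar_lt (Rabs x) (CV_radius a).
Proof.
  intros H Hx. destruct (CV_radius_bounded a) as [Hub _].
  apply Rbar_lt_le_trans with (Finite rho); [exact Hx|].
  apply Hub. now exists K.
Qed.

Lemma Rinv_INR_bound (n : nat) : 0 <= / INR n <= 1.
Proof.
  destruct n as [|n]; [simpl; rewrite Rinv_0; lra|].
  assert (1 <= INR (S n)) by (rewrite S_INR; pose proof (pos_INR n); lra).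
  split; [left; apply Rinv_0_lt_compat; lra|].
  rewrite <- Rinv_1. apply Rinv_le_contravar; lra.
Qed.

Lemma cos_Rabs_le (x : R) : Rabs (cos x) <= 1.
Proof. apply Rabs_le, COS_bound. Qed.

Lemma sin_Rabs_le (x : R) : Rabs (sin x) <= 1.
Proof. apply Rabs_le, SIN_bound. Qed.

(** [f] stands for [cos] or [sin]. *)
Lemma CV_radius_trig (f : R -> R) (phi x : R) (c : nat -> R) :
  (forall y, Rabs (f y) <= 1) -> (forall n, 0 <= c n <= 1) -> Rabs x < 1 ->
  Rbar_lt (Rabs x) (CV_radius (fun n => f (INR n * phi) * c n)).
Proof.
  intros Hf Hc. apply CV_radius_gt with 1. intros n.
  rewrite pow1, Rmult_1_r, Rabs_mult, (Rabs_pos_eq (c n)) by apply Hc.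
  rewrite <- (Rmult_1_r 1).
  apply Rmult_le_compat; auto using Rabs_pos; apply Hc.
Qed.

Lemma disk_denominator_pos (r phi : R) : 0 <= r < 1 -> 0 < 1 - 2 * r * cos phi + r ^ 2.
Proof. intros Hr. pose proof (COS_bound phi). nra. Qed.

(** The generating function of a sequence with characteristic polynomial X^2 - p X + 1, as are
    cos(n phi) and sin(n phi) with p = 2 cos phi. *)
Lemma PSeries_linear_recurrence (e : nat -> R) (p r : R) :
  Rbar_lt (Rabs r) (CV_radius e) ->
  (forall n, e (S (S n)) = p * e (S n) - e n) ->
  PSeries (fun n => e (S n)) r * (1 - p * r + r ^ 2) = e 1%nat - r * e 0%nat.
Proof.
  intros HCV He.
  assert (H0 : ex_series (fun n => e n * r ^ n)).
  { apply (ex_series_dominated _ (fun n => Rabs (e n * r ^ n))).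
    - intros; lra.
    - apply CV_disk_inside, HCV. }
  assert (H1 : ex_series (fun n => e (S n) * r ^ n)).
  { apply (ex_series_dominated _ (fun n => Rabs (e (S n) * r ^ n))); [intros; lra|].
    apply (CV_disk_inside (PS_decr_1 e)). rewrite CV_radius_decr_1. exact HCV. }
  assert (E : PSeries (fun n => e (S n)) r =
      e 1%nat + r * (p * PSeries (fun n => e (S n)) r - (e 0%nat + r * PSeries (fun n => e (S n)) r))).
  { unfold PSeries.
    assert (E0 : Series (fun n => e n * r ^ n) = e 0%nat + r * Series (fun n => e (S n) * r ^ n)).
    { rewrite Series_incr_1 by exact H0. rewrite <- Series_scal_l.
      simpl. f_equal; [ring|]. apply Series_ext; intros n; simpl; ring. }
    rewrite <- E0.
    rewrite Series_incr_1 at 1 by exact H1. simpl. rewrite Rmult_1_r. f_equal.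
    rewrite <- Series_scal_l, <- Series_minus;
      [|apply (ex_series_scal_l (K := R_AbsRing) (V := R_NormedModule)); exact H1|exact H0].
    rewrite <- Series_scal_l. apply Series_ext; intros n. rewrite He. ring. }
  lra.
Qed.

Lemma sum_cos_geometric (r phi : R) : 0 <= r < 1 ->
  PSeries (fun n => cos (INR (S n) * phi)) r = (cos phi - r) / (1 - 2 * r * cos phi + r ^ 2).
Proof.
  intros Hr. pose proof (disk_denominator_pos r phi Hr).
  assert (E : PSeries (fun n => cos (INR (S n) * phi)) r * (1 - 2 * cos phi * r + r ^ 2) =
              cos (INR 1 * phi) - r * cos (INR 0 * phi)).
  { apply (PSeries_linear_recurrence (fun n => cos (INR n * phi))).
    - apply CV_radius_gt with 1 1; [|rewrite Rabs_pos_eq; lra].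
      intros n. rewrite pow1, Rmult_1_r. apply cos_Rabs_le.
    - intros n. rewrite !S_INR.
      replace ((INR n + 1 + 1) * phi) with ((INR n + 1) * phi + phi) by ring.
      replace (INR n * phi) with ((INR n + 1) * phi - phi) by ring.
      rewrite cos_plus, cos_minus. ring. }
  replace (INR 1 * phi) with phi in E by (simpl; ring).
  replace (INR 0 * phi) with 0 in E by (simpl; ring).
  rewrite cos_0 in E.
  replace (2 * cos phi * r) with (2 * r * cos phi) in E by ring.
  apply Rmult_eq_reg_r with (1 - 2 * r * cos phi + r ^ 2); [|lra].
  rewrite E. field. lra.
Qed.

Lemma sum_sin_geometric (r phi : R) : 0 <= r < 1 ->
  PSeries (fun n => sin (INR (S n) * phi)) r = sin phi / (1 - 2 * r * cos phi + r ^ 2).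
Proof.
  intros Hr. pose proof (disk_denominator_pos r phi Hr).
  assert (E : PSeries (fun n => sin (INR (S n) * phi)) r * (1 - 2 * cos phi * r + r ^ 2) =
              sin (INR 1 * phi) - r * sin (INR 0 * phi)).
  { apply (PSeries_linear_recurrence (fun n => sin (INR n * phi))).
    - apply CV_radius_gt with 1 1; [|rewrite Rabs_pos_eq; lra].
      intros n. rewrite pow1, Rmult_1_r. apply sin_Rabs_le.
    - intros n. rewrite !S_INR.
      replace ((INR n + 1 + 1) * phi) with ((INR n + 1) * phi + phi) by ring.
      replace (INR n * phi) with ((INR n + 1) * phi - phi) by ring.
      rewrite sin_plus, sin_minus. ring. }
  replace (INR 1 * phi) with phi in E by (simpl; ring).
  replace (INR 0 * phi) with 0 in E by (simpl; ring).
  rewrite sin_0 in E.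
  replace (2 * cos phi * r) with (2 * r * cos phi) in E by ring.
  apply Rmult_eq_reg_r with (1 - 2 * r * cos phi + r ^ 2); [|lra].
  rewrite E. field. lra.
Qed.

(** Real part of -log(1 - z), z = r e^(i phi). *)
Definition logRe (r phi : R) : R := - ln (1 - 2 * r * cos phi + r ^ 2) / 2.

(** Imaginary part of -log(1 - z), written as its value on the unit circle minus an arctangent
    that vanishes as r -> 1. *)
Definition logIm (r phi : R) : R :=
  (PI - phi) / 2 - atan ((1 - r) / (1 + r) * (sin phi / (1 - cos phi))).

Lemma PS_derive_over_n (e : nat -> R) (r : R) :
  PSeries (PS_derive (fun n => e n * / INR n)) r = PSeries (fun n => e (S n)) r.
Proof.
  apply PSeries_ext; intros n. unfold PS_derive. field. apply not_0_INR; lia.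
Qed.

Lemma logRe_series (r phi : R) : 0 <= r < 1 ->
  PSeries (fun n => cos (INR n * phi) * / INR n) r = logRe r phi.
Proof.
  intros Hr.
  set (f := fun s => PSeries (fun n => cos (INR n * phi) * / INR n) s - logRe s phi).
  assert (E0 : f 0 = 0).
  { unfold f, logRe. rewrite PSeries_0. simpl INR. rewrite Rinv_0.
    replace (1 - 2 * 0 * cos phi + 0 ^ 2) with 1 by ring. rewrite ln_1. field. }
  assert (E : f 0 = f r); [|unfold f in *; lra].
  destruct (Req_dec r 0) as [->|Hr0]; [reflexivity|].
  apply eq_is_derive; [|lra]. intros t Ht.
  pose proof (disk_denominator_pos t phi) as Hd.
  unfold f. evar_last.
  { apply (is_derive_minus (K := R_AbsRing) (V := R_NormedModule)).
    - apply is_derive_PSeries, CV_radius_trig;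
        [apply cos_Rabs_le|apply Rinv_INR_bound|rewrite Rabs_pos_eq; lra].
    - unfold logRe. auto_derive; [simpl in Hd; lra|reflexivity]. }
  rewrite PS_derive_over_n, sum_cos_geometric by lra.
  unfold minus, plus, opp, zero; simpl in *. field. lra.
Qed.

Lemma one_minus_cos_pos (x : R) : 0 < x < 2 * PI -> 0 < 1 - cos x.
Proof.
  intros Hx. replace x with (2 * (x / 2)) by field. rewrite cos_2a_sin.
  pose proof (sin_gt_0 (x / 2)). nra.
Qed.

Lemma atan_half_cot (phi : R) : 0 < phi < 2 * PI ->
  atan (sin phi / (1 - cos phi)) = (PI - phi) / 2.
Proof.
  intros Hp. rewrite <- (atan_tan ((PI - phi) / 2)) by lra.
  f_equal. unfold tan.
  replace ((PI - phi) / 2) with (PI / 2 - phi / 2) by field.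
  rewrite sin_shift, cos_shift.
  assert (0 < sin (phi / 2)) by (apply sin_gt_0; lra).
  replace phi with (2 * (phi / 2)) at 1 2 by field. rewrite sin_2a, cos_2a_sin.
  field. split; nra.
Qed.

(** Both sides have the same derivative in r; at r = 0 the arctangent is (pi - phi)/2. *)
Lemma logIm_series (r phi : R) : 0 < phi < 2 * PI -> 0 <= r < 1 ->
  PSeries (fun n => sin (INR n * phi) * / INR n) r = logIm r phi.
Proof.
  intros Hp Hr. pose proof (one_minus_cos_pos phi Hp) as Hc.
  set (f := fun s => PSeries (fun n => sin (INR n * phi) * / INR n) s - logIm s phi).
  assert (E0 : f 0 = 0).
  { unfold f, logIm. rewrite PSeries_0. simpl INR. rewrite Rinv_0.
    replace ((1 - 0) / (1 + 0) * (sin phi / (1 - cos phi))) with (sin phi / (1 - cos phi)) by (field; lra).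
    rewrite atan_half_cot by assumption. field. }
  assert (E : f 0 = f r); [|unfold f in *; lra].
  destruct (Req_dec r 0) as [->|Hr0]; [reflexivity|].
  apply eq_is_derive; [|lra]. intros t Ht.
  pose proof (disk_denominator_pos t phi) as Hd.
  unfold f. evar_last.
  { apply (is_derive_minus (K := R_AbsRing) (V := R_NormedModule)).
    - apply is_derive_PSeries, CV_radius_trig;
        [apply sin_Rabs_le|apply Rinv_INR_bound|rewrite Rabs_pos_eq; lra].
    - unfold logIm. auto_derive; [lra|reflexivity]. }
  rewrite PS_derive_over_n, sum_sin_geometric by lra.
  unfold minus, plus, opp, zero; simpl in *.
  pose proof (sin2_cos2 phi) as Hs. unfold Rsqr in Hs.
  apply Rminus_diag_eq.
  set (s := sin phi) in *. set (c := cos phi) in *.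
  assert (Es : s * s = (1 - c) * (1 + c)) by lra.
  replace ((1 + - t) * / (1 + t) * (s / (1 - c)) * ((1 + - t) * / (1 + t) * (s / (1 - c)) * 1))
    with ((1 - t) ^ 2 * (1 + c) / ((1 + t) ^ 2 * (1 - c))).
  2: { apply Rmult_eq_reg_r with ((1 + t) ^ 2 * (1 - c) ^ 2); [|apply Rmult_integral_contrapositive_currified; apply pow_nonzero; lra].
    transitivity ((1 - t) ^ 2 * ((1 - c) * (1 + c))); [field; lra|]. rewrite <- Es. field. lra. }
  assert (0 < (1 + t) ^ 2 * (1 - c) + (1 - t) ^ 2 * (1 + c)).
  { replace ((1 + t) ^ 2 * (1 - c) + (1 - t) ^ 2 * (1 + c)) with (2 * (1 - 2 * t * c + t ^ 2)) by ring.
    simpl. lra. }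
  field. repeat split; try lra.
Qed.

(** The coefficients of log(1 - z)^2. *)
Definition logSq (n : nat) : R := sum_f_R0 (fun k => / INR k * / INR (n - k)) n.

Lemma sum_f_R0_sub (f g : nat -> R) (n : nat) :
  sum_f_R0 f n - sum_f_R0 g n = sum_f_R0 (fun k => f k - g k) n.
Proof. symmetry; apply minus_sum. Qed.

(** Real part of the Cauchy square of the series of -log(1 - z). *)
Lemma logSq_cos_series (r phi : R) : 0 < phi < 2 * PI -> 0 <= r < 1 ->
  Series (fun n => logSq n * (r ^ n * cos (INR n * phi))) = logRe r phi ^ 2 - logIm r phi ^ 2.
Proof.
  intros Hp Hr. rewrite <- logRe_series, <- logIm_series by assumption.
  assert (Ha := CV_radius_trig cos phi r (fun n => / INR n) cos_Rabs_le Rinv_INR_bound).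
  assert (Hb := CV_radius_trig sin phi r (fun n => / INR n) sin_Rabs_le Rinv_INR_bound).
  rewrite Rabs_pos_eq in Ha, Hb by lra.
  rewrite <- Rsqr_pow2, <- Rsqr_pow2. unfold Rsqr.
  rewrite <- !PSeries_mult by (rewrite Rabs_pos_eq by lra; first [apply Ha|apply Hb]; lra).
  rewrite <- PSeries_minus.
  2, 3: apply ex_pseries_mult; rewrite Rabs_pos_eq by lra; first [apply Ha; lra|apply Hb; lra].
  apply Series_ext; intros n. unfold PS_minus, PS_plus, PS_opp, PS_mult, logSq, plus, opp; simpl.
  fold (Rminus (sum_f_R0 (fun k => cos (INR k * phi) * / INR k * (cos (INR (n - k) * phi) * / INR (n - k))) n)
   (sum_f_R0 (fun k => sin (INR k * phi) * / INR k * (sin (INR (n - k) * phi) * / INR (n - k))) n)).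
  rewrite sum_f_R0_sub, (Rmult_comm (r ^ n)), <- Rmult_assoc. f_equal.
  rewrite (Rmult_comm _ (cos _)), scal_sum. apply sum_eq; intros k Hk.
  replace (INR n) with (INR k + INR (n - k)) by (rewrite <- plus_INR; f_equal; lia).
  rewrite Rmult_plus_distr_r, cos_plus. ring.
Qed.

(** Imaginary part of the same Cauchy square. *)
Lemma logSq_sin_series (r phi : R) : 0 < phi < 2 * PI -> 0 <= r < 1 ->
  Series (fun n => logSq n * (r ^ n * sin (INR n * phi))) = 2 * logRe r phi * logIm r phi.
Proof.
  intros Hp Hr. rewrite <- logRe_series, <- logIm_series by assumption.
  assert (Ha := CV_radius_trig cos phi r (fun n => / INR n) cos_Rabs_le Rinv_INR_bound).
  assert (Hb := CV_radius_trig sin phi r (fun n => / INR n) sin_Rabs_le Rinv_INR_bound).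
  rewrite Rabs_pos_eq in Ha, Hb by lra.
  set (a := fun n => cos (INR n * phi) * / INR n) in *.
  set (b := fun n => sin (INR n * phi) * / INR n) in *.
  replace (2 * PSeries a r * PSeries b r) with (PSeries a r * PSeries b r + PSeries b r * PSeries a r) by ring.
  rewrite <- !PSeries_mult by (rewrite Rabs_pos_eq by lra; first [apply Ha|apply Hb]; lra).
  rewrite <- PSeries_plus.
  2, 3: apply ex_pseries_mult; rewrite Rabs_pos_eq by lra; first [apply Ha; lra|apply Hb; lra].
  apply Series_ext; intros n. unfold PS_plus, PS_mult, logSq, plus; simpl.
  rewrite <- plus_sum, (Rmult_comm (r ^ n)), <- Rmult_assoc. f_equal.
  rewrite (Rmult_comm _ (sin _)), scal_sum. apply sum_eq; intros k Hk.
  unfold a, b.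
  replace (INR n) with (INR k + INR (n - k)) by (rewrite <- plus_INR; f_equal; lia).
  rewrite Rmult_plus_distr_r, sin_plus. ring.
Qed.

(** * Summable coefficients *)

(** Reciprocal powers; since / 0 = 0, the index 0 contributes nothing when k > 0. *)
Definition ipow (k n : nat) : R := (/ INR n) ^ k.

Definition harmonic (n : nat) : R := sum_f_R0 (fun k => / INR k) n.

Lemma ipow_bound (k n : nat) : 0 <= ipow k n <= 1.
Proof.
  unfold ipow. pose proof (Rinv_INR_bound n). split; [apply pow_le; lra|].
  rewrite <- (pow1 k). apply pow_incr; lra.
Qed.

Lemma ipow_decr (k n : nat) : ipow (S k) n <= ipow k n.
Proof.
  change (/ INR n * ipow k n <= ipow k n).
  pose proof (ipow_bound k n). pose proof (Rinv_INR_bound n). nra.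
Qed.

Lemma ipow_0 (k : nat) : ipow (S k) 0 = 0.
Proof. unfold ipow. simpl. rewrite Rinv_0. ring. Qed.

Lemma INR_mul_ipow (k n : nat) : INR n * ipow (S (S k)) n = ipow (S k) n.
Proof.
  destruct n as [|n]; [rewrite !ipow_0; ring|].
  unfold ipow. change ((/ INR (S n)) ^ S (S k)) with (/ INR (S n) * (/ INR (S n)) ^ S k).
  rewrite <- Rmult_assoc, Rinv_r, Rmult_1_l by (apply not_0_INR; lia). reflexivity.
Qed.

Lemma ex_series_telescope (a g : nat -> R) :
  (forall n, 0 <= a n <= g n - g (S n)) -> (forall n, 0 <= g n) -> ex_series a.
Proof.
  intros Ha Hg.
  assert (Hb : forall n, sum_n a n <= g 0%nat - g (S n)).
  { intros n; induction n as [|n IH].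
    - rewrite sum_O. apply Ha.
    - rewrite sum_Sn. unfold plus; simpl. pose proof (Ha (S n)). lra. }
  destruct (ex_finite_lim_seq_incr (sum_n a) (g 0%nat)) as [l Hl].
  - intros n. rewrite sum_Sn. unfold plus; simpl. pose proof (Ha (S n)). lra.
  - intros n. pose proof (Hb n). pose proof (Hg (S n)). lra.
  - exists l. exact Hl.
Qed.

Lemma ex_series_ipow (k : nat) : ex_series (ipow (S (S k))).
Proof.
  apply (ex_series_incr_1 (K := R_AbsRing) (V := R_NormedModule)).
  apply ex_series_telescope with (fun n => 2 * / INR (S n)).
  2: { intros n. pose proof (Rinv_INR_bound (S n)). lra. }
  intros n. split; [apply ipow_bound|].
  unfold ipow.
  assert (Hk : (/ INR (S n)) ^ S (S k) <= (/ INR (S n)) ^ 2).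
  { replace (S (S k)) with (2 + k)%nat by lia. rewrite pow_add.
    rewrite <- (Rmult_1_r ((/ INR (S n)) ^ 2)) at 2.
    apply Rmult_le_compat_l; [apply (ipow_bound 2)|apply (ipow_bound k)]. }
  eapply Rle_trans; [exact Hk|].
  rewrite !S_INR. pose proof (pos_INR n).
  apply Rminus_le_0.
  replace (2 * / (INR n + 1) - 2 * / (INR n + 1 + 1) - (/ (INR n + 1)) ^ 2)
    with (INR n * / ((INR n + 1) ^ 2 * (INR n + 2))) by (field; lra).
  apply Rmult_le_pos; [lra|]. left. apply Rinv_0_lt_compat. nra.
Qed.

Lemma zeta_ipow (k : nat) : zeta (S (S k)) = Series (ipow (S (S k))).
Proof.
  rewrite Series_incr_1 by apply ex_series_ipow. rewrite ipow_0, Rplus_0_l.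
  unfold zeta. apply Series_ext; intros n. unfold ipow.
  rewrite pow_inv. unfold Rdiv. ring.
Qed.

Lemma sum_f_R0_rev (f : nat -> R) (n : nat) :
  sum_f_R0 (fun k => f (n - k)%nat) n = sum_f_R0 f n.
Proof.
  induction n as [|n IH]; [reflexivity|].
  rewrite decomp_sum by lia. simpl pred.
  rewrite (sum_eq _ (fun k => f (n - k)%nat)) by (intros; f_equal; lia).
  rewrite IH. simpl. ring.
Qed.

Lemma harmonic_S (n : nat) : harmonic (S n) = harmonic n + / INR (S n).
Proof. reflexivity. Qed.

Lemma harmonic_nonneg (n : nat) : 0 <= harmonic n.
Proof.
  apply cond_pos_sum; intros k. apply Rinv_INR_bound.
Qed.

Lemma harmonic_le (n : nat) : harmonic n <= INR n.
Proof.
  induction n as [|n IH].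
  - unfold harmonic. simpl. rewrite Rinv_0. lra.
  - rewrite harmonic_S, S_INR. pose proof (Rinv_INR_bound (S n)). rewrite S_INR in *. lra.
Qed.

(** Partial fractions: n / (k (n - k)) = 1 / k + 1 / (n - k). *)
Lemma logSq_harmonic (m : nat) : logSq (S m) = 2 * harmonic m * / INR (S m).
Proof.
  assert (Hm : INR (S m) <> 0) by (apply not_0_INR; lia).
  assert (E : logSq (S m) = / INR (S m) *
    (sum_f_R0 (fun k => if Nat.eq_dec k (S m) then 0 else / INR k) (S m) +
     sum_f_R0 (fun k => if Nat.eq_dec k 0 then 0 else / INR (S m - k)) (S m))).
  { unfold logSq. rewrite <- plus_sum, scal_sum. apply sum_eq; intros k Hk.
    destruct (Nat.eq_dec k (S m)) as [->|H1].
    - rewrite Nat.sub_diag. simpl (INR 0). rewrite Rinv_0.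
      destruct (Nat.eq_dec (S m) 0); ring.
    - destruct (Nat.eq_dec k 0) as [->|H0].
      + simpl (INR 0). rewrite Rinv_0. ring.
      + rewrite minus_INR by lia.
        assert (INR k <> 0) by (apply not_0_INR; lia).
        assert (INR (S m) - INR k <> 0).
        { rewrite <- minus_INR by lia. apply not_0_INR; lia. }
        field. auto. }
  rewrite E. clear E.
  rewrite tech5, (decomp_sum _ (S m)) by lia. simpl pred.
  destruct (Nat.eq_dec (S m) (S m)); [|lia]. destruct (Nat.eq_dec 0 0); [|lia].
  rewrite (sum_eq _ (fun k => / INR k) m).
  2: { intros k Hk. destruct (Nat.eq_dec k (S m)); [lia|reflexivity]. }
  rewrite (sum_eq (fun i => if Nat.eq_dec (S i) 0 then _ else _) (fun k => / INR (m - k)) m).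
  2: { intros k Hk. reflexivity. }
  rewrite (sum_f_R0_rev (fun k => / INR k)). unfold harmonic. ring.
Qed.

Lemma logSq_0 : logSq 0 = 0.
Proof. unfold logSq. simpl. rewrite Rinv_0. ring. Qed.

Lemma logSq_1 : logSq 1 = 0.
Proof. unfold logSq. simpl. rewrite Rinv_0. ring. Qed.

Lemma logSq_bound (n : nat) : 0 <= logSq n <= 2.
Proof.
  destruct n as [|m]; [rewrite logSq_0; lra|].
  rewrite logSq_harmonic.
  pose proof (harmonic_nonneg m). pose proof (harmonic_le m).
  pose proof (Rinv_INR_bound (S m)). rewrite S_INR in *. pose proof (pos_INR m).
  split; [apply Rmult_le_pos; lra|].
  apply Rmult_le_reg_r with (INR m + 1); [lra|].
  rewrite Rmult_assoc, Rinv_l by lra. lra.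
Qed.

(** The coefficients are 2 H_m / (m+1)^2 or less, and (H_m + 2) / (m+1) decreases fast enough to
    majorize them by its differences. *)
Lemma ex_series_logSq (k : nat) : ex_series (fun n => logSq n * ipow (S k) n).
Proof.
  apply (ex_series_incr_1 (K := R_AbsRing) (V := R_NormedModule)).
  apply ex_series_telescope with (fun m => 4 * ((harmonic m + 2) * / INR (S m))).
  2: { intros n. pose proof (Rinv_INR_bound (S n)). pose proof (harmonic_nonneg n). nra. }
  intros m. split.
  { apply Rmult_le_pos; [apply logSq_bound|apply ipow_bound]. }
  assert (Hk : ipow (S k) (S m) <= ipow 1 (S m)).
  { unfold ipow. simpl. rewrite Rmult_1_r.
    pose proof (ipow_bound k (S m)). pose proof (Rinv_INR_bound (S m)).
    unfold ipow in *. simpl in *. nra. }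
  pose proof (logSq_bound (S m)). pose proof (harmonic_nonneg m) as Hh.
  apply Rle_trans with (logSq (S m) * ipow 1 (S m)); [nra|].
  rewrite logSq_harmonic, harmonic_S. unfold ipow. rewrite !S_INR, pow_1.
  pose proof (pos_INR m).
  apply Rminus_le_0.
  match goal with |- 0 <= ?e => replace e with
   ((2 * harmonic m * INR m + 4 * (INR m + 1)) * / ((INR m + 1) ^ 2 * (INR m + 2))) by (field; lra) end.
  apply Rmult_le_pos; [nra|]. left. apply Rinv_0_lt_compat. nra.
Qed.

(** * Trigonometric series *)

Definition trigSeries (f : R -> R) (a : nat -> R) (x : R) : R :=
  Series (fun n => a n * f (INR n * x)).

Notation cosSeries := (trigSeries cos).
Notation sinSeries := (trigSeries sin).

Section Trig.

Variables f g : R -> R.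
Hypothesis Hf : forall y, is_derive f y (g y).
Hypothesis Hf1 : forall y, Rabs (f y) <= 1.
Hypothesis Hg1 : forall y, Rabs (g y) <= 1.

Let term_bound (h : R -> R) (a c y : R) :
  (forall y, Rabs (h y) <= 1) -> Rabs a <= c -> Rabs (a * h y) <= c.
Proof.
  intros Hh Ha. rewrite Rabs_mult, <- (Rmult_1_r c).
  apply Rmult_le_compat; auto using Rabs_pos.
Qed.

Let term_derive (a : R) (n : nat) (y : R) :
  is_derive (fun z => a * f (INR n * z)) y (INR n * a * g (INR n * y)).
Proof.
  evar_last.
  - apply is_derive_scal. apply (is_derive_comp f (fun z => INR n * z)).
    + apply Hf.
    + auto_derive; [trivial|reflexivity].
  - unfold scal, mult; simpl; unfold mult; simpl. ring.
Qed.

Lemma continuous_trigSeries (a : nat -> R) (x : R) :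
  ex_series (fun n => Rabs (a n)) -> continuous (trigSeries f a) x.
Proof.
  intros Ha. unfold continuous, trigSeries.
  apply (filterlim_Series (F := locally x) (fun n y => a n * f (INR n * y)) _ _ Ha).
  - apply filter_forall. intros y n. apply term_bound; auto; lra.
  - intros n. apply (ex_derive_continuous (fun y => a n * f (INR n * y))).
    eexists. apply term_derive.
Qed.

Lemma is_derive_trigSeries (a : nat -> R) (x : R) :
  ex_series (fun n => Rabs (a n)) -> ex_series (fun n => Rabs (INR n * a n)) ->
  is_derive (trigSeries f a) x (trigSeries g (fun n => INR n * a n) x).
Proof.
  intros Ha Hb. unfold trigSeries.
  apply (is_derive_Series _ (fun n y => INR n * a n * g (INR n * y)) _ _ Hb).
  - apply filter_forall. intros y n. split; [apply term_derive|].
    apply term_bound; auto; lra.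
  - apply filter_forall. intros y. apply ex_series_dominated with (2 := Ha).
    intros n. apply term_bound; auto; lra.
Qed.

(** The coefficients of the differentiated series need only be bounded; its sum is replaced by the
    limit [l] of the Abel means [h]. *)
Lemma is_derive_trigSeries_radial (a : nat -> R) (K : R) (h : R -> R -> R) (x l : R) :
  ex_series (fun n => Rabs (a n)) -> (forall n, Rabs (INR n * a n) <= K) ->
  locally x (fun y => forall r, 0 < r < 1 ->
     Series (fun n => INR n * a n * (r ^ n * g (INR n * y))) = h r y) ->
  filterlim (fun p => h (fst p) (snd p)) (filter_prod (at_left 1) (locally x)) (locally l) ->
  is_derive (trigSeries f a) x l.
Proof.
  intros Ha HK Hh Hl.
  apply (is_derive_radial_limit
    (fun r y => Series (fun n => a n * r ^ n * f (INR n * y))) h _ _ _); [|exact Hl|].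
  - revert Hh; apply filter_imp; intros y Hy r Hr.
    rewrite <- Hy by assumption.
    rewrite (Series_ext _ (fun n => INR n * (a n * r ^ n) * g (INR n * y))) by (intros; ring).
    apply (is_derive_Series _ (fun n y => INR n * (a n * r ^ n) * g (INR n * y)) (fun n => K * r ^ n)).
    + apply (ex_series_scal_l (K := R_AbsRing) (V := R_NormedModule)), ex_series_geom.
      rewrite Rabs_pos_eq; lra.
    + apply filter_forall. intros z n. split; [apply term_derive|].
      apply term_bound; auto. rewrite <- Rmult_assoc, Rabs_mult.
      pose proof (pow_le r n). rewrite (Rabs_pos_eq (r ^ n)) by lra.
      apply Rmult_le_compat_r; auto; lra.
    + apply filter_forall. intros z. apply ex_series_dominated with (2 := Ha).
      intros n. apply term_bound; auto. rewrite Rabs_mult.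
      rewrite <- (Rmult_1_r (Rabs (a n))) at 2.
      apply Rmult_le_compat_l; [apply Rabs_pos|].
      rewrite <- RPow_abs, Rabs_pos_eq by lra. rewrite <- (pow1 n). apply pow_incr; lra.
  - apply filter_forall. intros y.
    assert (H01 : at_left 1 (fun r => 0 < r < 1)).
    { exists (mkposreal 1 Rlt_0_1). intros r Hr Hr1. change (Rabs (r - 1) < 1) in Hr.
      apply Rabs_def2 in Hr. lra. }
    apply (filterlim_Series (F := at_left 1) (fun n r => a n * r ^ n * f (INR n * y)) _ _ Ha).
    + revert H01; apply filter_imp; intros r Hr n.
      apply term_bound; auto. rewrite Rabs_mult.
      rewrite <- (Rmult_1_r (Rabs (a n))) at 2.
      apply Rmult_le_compat_l; [apply Rabs_pos|].
      rewrite <- RPow_abs, Rabs_pos_eq by lra. rewrite <- (pow1 n). apply pow_incr; lra.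
    + intros n. refine (filterlim_filter_le_1 (F := locally 1) (G := at_left 1) _ _ _).
      { intros P HP. unfold at_left, within. revert HP; apply filter_imp; auto. }
      replace (a n * f (INR n * y)) with (a n * 1 ^ n * f (INR n * y)) by (rewrite pow1; ring).
      apply (ex_derive_continuous (fun r => a n * r ^ n * f (INR n * y))).
      auto_derive. trivial.
Qed.

End Trig.

Lemma is_derive_cos_opp_sin (y : R) : is_derive cos y (- sin y).
Proof. apply is_derive_Reals, derivable_pt_lim_cos. Qed.

Lemma is_derive_sin_cos (y : R) : is_derive sin y (cos y).
Proof. apply is_derive_Reals, derivable_pt_lim_sin. Qed.

Lemma opp_sin_Rabs_le (y : R) : Rabs (- sin y) <= 1.
Proof. rewrite Rabs_Ropp. apply sin_Rabs_le. Qed.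

(** log |1 - e^(ix)| *)
Definition logSin (x : R) : R := ln (2 - 2 * cos x) / 2.

Definition sawtooth (x : R) : R := (PI - x) / 2.

Lemma filterlim_Rcomp {T : Type} {F : (T -> Prop) -> Prop} {FF : Filter F}
  (f : R -> R) (u : T -> R) (a : R) :
  ex_derive f a -> filterlim u F (locally a) ->
  filterlim (fun x => f (u x)) F (locally (f a)).
Proof.
  intros Hf Hu. eapply filterlim_comp; [exact Hu|]. apply (ex_derive_continuous f a Hf).
Qed.

Section JointLimit.

Variable x : R.
Hypothesis Hx : 0 < x < 2 * PI.

Let F := filter_prod (at_left 1) (locally x).

Let lim_fst : filterlim (fun p : R * R => fst p) F (locally 1).
Proof.
  eapply filterlim_filter_le_2; [|apply filterlim_fst].
  intros P HP. unfold at_left, within. revert HP; apply filter_imp; auto.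
Qed.

Let lim_snd : filterlim (fun p : R * R => snd p) F (locally x).
Proof. apply filterlim_snd. Qed.

Lemma logRe_radial_limit :
  filterlim (fun p => logRe (fst p) (snd p)) F (locally (- logSin x)).
Proof.
  pose proof (one_minus_cos_pos x Hx).
  unfold logRe.
  replace (- logSin x) with ((fun z => - ln z / 2) (1 - 2 * 1 * cos x + 1 * 1)).
  2: { unfold logSin. replace (2 - 2 * cos x) with (1 - 2 * 1 * cos x + 1 * 1) by ring. simpl. field. }
  apply (filterlim_Rcomp (fun z => - ln z / 2) (fun p : R * R => 1 - 2 * fst p * cos (snd p) + fst p ^ 2)).
  { auto_derive. lra. }
  apply filterlim_Rplus.
  - apply filterlim_Rminus; [apply filterlim_const|].
    apply filterlim_Rmult; [apply filterlim_Rmult; [apply filterlim_const|apply lim_fst]|].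
    apply (filterlim_Rcomp cos); [auto_derive; trivial|apply lim_snd].
  - apply filterlim_ext with (fun p : R * R => fst p * fst p); [intros; ring|].
    apply filterlim_Rmult; apply lim_fst.
Qed.

Lemma logIm_radial_limit :
  filterlim (fun p => logIm (fst p) (snd p)) F (locally (sawtooth x)).
Proof.
  pose proof (one_minus_cos_pos x Hx).
  unfold logIm.
  replace (sawtooth x) with (sawtooth x - atan ((1 - 1) / (1 + 1) * (sin x / (1 - cos x)))).
  2: { replace ((1 - 1) / (1 + 1) * (sin x / (1 - cos x))) with 0 by (field; lra).
       rewrite atan_0; ring. }
  apply filterlim_Rminus.
  - apply (filterlim_Rcomp sawtooth (fun p : R * R => snd p)); [|apply lim_snd].
    unfold sawtooth. auto_derive. trivial.
  - apply (filterlim_Rcomp atan); [eexists; apply is_derive_atan|].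
    apply filterlim_Rmult.
    + apply (filterlim_Rcomp (fun r => (1 - r) / (1 + r)) (fun p : R * R => fst p)); [|apply lim_fst].
      auto_derive. lra.
    + apply (filterlim_Rcomp (fun y => sin y / (1 - cos y)) (fun p : R * R => snd p)); [|apply lim_snd].
      auto_derive. lra.
Qed.

End JointLimit.

Lemma locally_between (a b x : R) : a < x < b -> locally x (fun y => a < y < b).
Proof.
  intros Hx. apply (locally_interval _ x a b); simpl; try apply Hx. auto.
Qed.

Lemma ex_series_Rabs_ipow (k : nat) : ex_series (fun n => Rabs (ipow (S (S k)) n)).
Proof.
  apply ex_series_ext with (ipow (S (S k))); [|apply ex_series_ipow].
  intros n. symmetry. apply Rabs_pos_eq, ipow_bound.
Qed.

Lemma ipow_1 (n : nat) : ipow 1 n = / INR n.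
Proof. unfold ipow. ring. Qed.

Lemma is_derive_sinSeries_2 (x : R) : 0 < x < 2 * PI ->
  is_derive (sinSeries (ipow 2)) x (- logSin x).
Proof.
  intros Hx.
  apply (is_derive_trigSeries_radial sin cos is_derive_sin_cos sin_Rabs_le cos_Rabs_le
    (ipow 2) 1 logRe).
  - apply ex_series_Rabs_ipow.
  - intros n. rewrite INR_mul_ipow, Rabs_pos_eq; apply ipow_bound.
  - apply filter_forall. intros y r Hr. rewrite <- logRe_series by lra.
    apply Series_ext; intros n. rewrite INR_mul_ipow, ipow_1. cbv beta. ring.
  - apply logRe_radial_limit, Hx.
Qed.

Lemma is_derive_cosSeries_2 (x : R) : 0 < x < 2 * PI ->
  is_derive (cosSeries (ipow 2)) x (- sawtooth x).
Proof.
  intros Hx.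
  apply (is_derive_trigSeries_radial cos (fun y => - sin y) is_derive_cos_opp_sin cos_Rabs_le opp_sin_Rabs_le
    (ipow 2) 1 (fun r y => 0 - logIm r y)).
  - apply ex_series_Rabs_ipow.
  - intros n. rewrite INR_mul_ipow, Rabs_pos_eq; apply ipow_bound.
  - apply filter_imp with (2 := locally_between _ _ _ Hx). intros y Hy r Hr.
    rewrite <- logIm_series by lra. unfold Rminus. rewrite Rplus_0_l. unfold PSeries.
    rewrite <- Series_opp.
    apply Series_ext; intros n. rewrite INR_mul_ipow, ipow_1. cbv beta. ring.
  - replace (- sawtooth x) with (0 - sawtooth x) by ring.
    apply filterlim_Rminus; [apply filterlim_const|apply logIm_radial_limit, Hx].
Qed.

Lemma ex_series_Rabs_logSq (k : nat) : ex_series (fun n => Rabs (logSq n * ipow (S k) n)).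
Proof.
  apply ex_series_ext with (fun n => logSq n * ipow (S k) n); [|apply ex_series_logSq].
  intros n. symmetry. apply Rabs_pos_eq, Rmult_le_pos; [apply logSq_bound|apply ipow_bound].
Qed.

Lemma INR_mul_logSq (k n : nat) :
  INR n * (logSq n * ipow (S (S k)) n) = logSq n * ipow (S k) n.
Proof. rewrite <- (INR_mul_ipow k n). ring. Qed.

Lemma INR_mul_logSq_1 (n : nat) : INR n * (logSq n * ipow 1 n) = logSq n.
Proof.
  rewrite ipow_1. destruct n as [|n]; [rewrite logSq_0; ring|].
  field. apply not_0_INR; lia.
Qed.

Lemma is_derive_cosSeries_logSq (x : R) : 0 < x < 2 * PI ->
  is_derive (cosSeries (fun n => logSq n * ipow 1 n)) x (2 * logSin x * sawtooth x).
Proof.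
  intros Hx.
  apply (is_derive_trigSeries_radial cos (fun y => - sin y) is_derive_cos_opp_sin cos_Rabs_le opp_sin_Rabs_le
    _ 2 (fun r y => -2 * (logRe r y * logIm r y))).
  - apply ex_series_Rabs_logSq.
  - intros n. rewrite INR_mul_logSq_1, Rabs_pos_eq; apply logSq_bound.
  - apply filter_imp with (2 := locally_between _ _ _ Hx). intros y Hy r Hr.
    replace (-2 * (logRe r y * logIm r y)) with (- (2 * logRe r y * logIm r y)) by ring.
    rewrite <- logSq_sin_series by lra.
    rewrite <- Series_opp.
    apply Series_ext; intros n. rewrite INR_mul_logSq_1. ring.
  - replace (2 * logSin x * sawtooth x) with (-2 * (- logSin x * sawtooth x)) by ring.
    apply filterlim_Rmult; [apply filterlim_const|].
    apply filterlim_Rmult; [apply logRe_radial_limit, Hx|apply logIm_radial_limit, Hx].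
Qed.

Lemma trigSeries_ext (f : R -> R) (a b : nat -> R) (x : R) :
  (forall n, a n = b n) -> trigSeries f a x = trigSeries f b x.
Proof. intros H. apply Series_ext; intros n. now rewrite H. Qed.

Lemma trigSeries_opp_sin (a : nat -> R) (x : R) :
  trigSeries (fun y => - sin y) a x = - sinSeries a x.
Proof. unfold trigSeries. rewrite <- Series_opp. apply Series_ext; intros; ring. Qed.

Lemma is_derive_cosSeries (a b : nat -> R) (x : R) :
  ex_series (fun n => Rabs (a n)) -> ex_series (fun n => Rabs (b n)) ->
  (forall n, INR n * a n = b n) -> is_derive (cosSeries a) x (- sinSeries b x).
Proof.
  intros Ha Hb H. rewrite <- trigSeries_opp_sin, <- (trigSeries_ext _ (fun n => INR n * a n)) by exact H.
  apply is_derive_trigSeries; auto using is_derive_cos_opp_sin, cos_Rabs_le, opp_sin_Rabs_le.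
  apply ex_series_ext with (2 := Hb). intros; now rewrite H.
Qed.

Lemma is_derive_sinSeries (a b : nat -> R) (x : R) :
  ex_series (fun n => Rabs (a n)) -> ex_series (fun n => Rabs (b n)) ->
  (forall n, INR n * a n = b n) -> is_derive (sinSeries a) x (cosSeries b x).
Proof.
  intros Ha Hb H. rewrite <- (trigSeries_ext _ (fun n => INR n * a n)) by exact H.
  apply is_derive_trigSeries; auto using is_derive_sin_cos, cos_Rabs_le, sin_Rabs_le.
  apply ex_series_ext with (2 := Hb). intros; now rewrite H.
Qed.

Lemma continuous_cosSeries (a : nat -> R) (x : R) :
  ex_series (fun n => Rabs (a n)) -> continuous (cosSeries a) x.
Proof.
  apply (continuous_trigSeries cos (fun y => - sin y));
    auto using is_derive_cos_opp_sin, cos_Rabs_le, opp_sin_Rabs_le.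
Qed.

Lemma continuous_sinSeries (a : nat -> R) (x : R) :
  ex_series (fun n => Rabs (a n)) -> continuous (sinSeries a) x.
Proof.
  apply (continuous_trigSeries sin cos); auto using is_derive_sin_cos, cos_Rabs_le, sin_Rabs_le.
Qed.

Lemma continuous_Rmult (f g : R -> R) (x : R) :
  continuous f x -> continuous g x -> continuous (fun y => f y * g y) x.
Proof. intros Hf Hg. apply (continuous_mult (U := R_UniformSpace) (K := R_AbsRing) f g x Hf Hg). Qed.

Lemma continuous_Rplus (f g : R -> R) (x : R) :
  continuous f x -> continuous g x -> continuous (fun y => f y + g y) x.
Proof.
  intros Hf Hg. apply (continuous_plus (U := R_UniformSpace) (V := R_NormedModule) f g x Hf Hg).
Qed.

(** * Power series with inverse central binomial coefficients *)

Definition cbinv (n : nat) : R := / central_binomial n.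

(** |1 - e^(ix)|^2 *)
Definition chord2 (x : R) : R := 2 - 2 * cos x.

Lemma central_binomial_pos (n : nat) : 0 < central_binomial n.
Proof.
  unfold central_binomial, Binomial.C.
  apply Rdiv_lt_0_compat; [|apply Rmult_lt_0_compat]; apply INR_fact_lt_0.
Qed.

Lemma central_binomial_S (n : nat) :
  INR (S n) * central_binomial (S n) = 2 * (2 * INR n + 1) * central_binomial n.
Proof.
  unfold central_binomial, Binomial.C.
  replace (2 * S n - S n)%nat with (S n) by lia.
  replace (2 * n - n)%nat with n by lia.
  replace (2 * S n)%nat with (S (S (2 * n))) by lia.
  rewrite !fact_simpl, !mult_INR, !S_INR, mult_INR.
  pose proof (INR_fact_neq_0 n). pose proof (pos_INR n). simpl (INR 2).
  field. split; lra.
Qed.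

Lemma cbinv_S (n : nat) : cbinv n = (INR n + 1) * (4 * INR n + 2) * (ipow 2 (S n) * cbinv (S n)).
Proof.
  pose proof (central_binomial_S n) as E. unfold cbinv, ipow.
  pose proof (central_binomial_pos n). pose proof (central_binomial_pos (S n)).
  rewrite S_INR in *. pose proof (pos_INR n).
  replace (central_binomial (S n)) with (2 * (2 * INR n + 1) * central_binomial n / (INR n + 1)).
  - field. split; lra.
  - rewrite <- E. field. lra.
Qed.

Lemma cbinv_bound (n : nat) : 0 < cbinv n <= (/ 2) ^ n.
Proof.
  induction n as [|n IH].
  - unfold cbinv, central_binomial, Binomial.C. simpl. lra.
  - split; [apply Rinv_0_lt_compat, central_binomial_pos|].
    rewrite cbinv_S in IH. unfold ipow in IH. rewrite S_INR in IH. pose proof (pos_INR n).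
    assert (0 < cbinv (S n)) by apply Rinv_0_lt_compat, central_binomial_pos.
    replace ((INR n + 1) * (4 * INR n + 2) * ((/ (INR n + 1)) ^ 2 * cbinv (S n)))
      with (2 * cbinv (S n) + 2 * INR n * / (INR n + 1) * cbinv (S n)) in IH by (field; lra).
    assert (0 <= 2 * INR n * / (INR n + 1) * cbinv (S n)).
    { apply Rmult_le_pos; [|lra]. apply Rmult_le_pos; [lra|]. left; apply Rinv_0_lt_compat; lra. }
    simpl. lra.
Qed.

Definition cbcoef (c : nat -> R) (n : nat) : R := c n * (ipow 2 n * cbinv n).

Definition cbSeries (c : nat -> R) (x : R) : R := PSeries (cbcoef c) (chord2 x).

Definition cbSeries' (c : nat -> R) (x : R) : R :=
  PSeries (PS_derive (cbcoef c)) (chord2 x) * (2 * sin x).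

Definition bounded_seq (a : nat -> R) : Prop := exists K, forall n, Rabs (a n) <= K.

(** Since C(2n,n) >= 2^n, the radius is at least 2, and t < 2 where cos x > 0. *)
Lemma CV_radius_cb (a : nat -> R) (x : R) :
  bounded_seq a -> 0 < cos x -> Rbar_lt (Rabs (chord2 x)) (CV_radius (fun n => a n * cbinv n)).
Proof.
  intros [K HK] Hx. apply CV_radius_gt with K 2.
  - intros n. pose proof (cbinv_bound n) as Hb. pose proof (pow_lt 2 n).
    rewrite Rmult_assoc, Rabs_mult, (Rabs_pos_eq (cbinv n * 2 ^ n)) by (apply Rmult_le_pos; lra).
    rewrite <- (Rmult_1_r K). apply Rmult_le_compat; auto using Rabs_pos; [apply Rmult_le_pos; lra|].
    replace 1 with ((/ 2) ^ n * 2 ^ n); [apply Rmult_le_compat_r; lra|].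
    rewrite <- Rpow_mult_distr, Rinv_l, pow1 by lra. reflexivity.
  - unfold chord2. pose proof (COS_bound x). rewrite Rabs_pos_eq; lra.
Qed.

Lemma CV_radius_cbcoef (c : nat -> R) (x : R) :
  bounded_seq (fun n => c n * ipow 2 n) -> 0 < cos x -> Rbar_lt (Rabs (chord2 x)) (CV_radius (cbcoef c)).
Proof.
  intros Hc Hx. rewrite (CV_radius_ext _ (fun n => c n * ipow 2 n * cbinv n)).
  - now apply CV_radius_cb.
  - intros n. unfold cbcoef. ring.
Qed.

Lemma is_derive_chord2 (x : R) : is_derive chord2 x (2 * sin x).
Proof. unfold chord2. auto_derive; [trivial|ring]. Qed.

Lemma is_derive_PSeries_chord2 (a : nat -> R) (x : R) :
  Rbar_lt (Rabs (chord2 x)) (CV_radius a) ->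
  is_derive (fun y => PSeries a (chord2 y)) x (PSeries (PS_derive a) (chord2 x) * (2 * sin x)).
Proof.
  intros H. evar_last.
  - apply (is_derive_comp (PSeries a) chord2); [apply is_derive_PSeries, H|apply is_derive_chord2].
  - unfold scal; simpl; unfold mult; simpl. ring.
Qed.

Lemma is_derive_cbSeries (c : nat -> R) (x : R) :
  bounded_seq (fun n => c n * ipow 2 n) -> 0 < cos x ->
  is_derive (cbSeries c) x (cbSeries' c x).
Proof. intros Hc Hx. apply is_derive_PSeries_chord2, CV_radius_cbcoef; assumption. Qed.

Lemma PS_incr_derive (a : nat -> R) (n : nat) : PS_incr_1 (PS_derive a) n = INR n * a n.
Proof. destruct n; [symmetry; apply Rmult_0_l|reflexivity]. Qed.

Lemma PS_incr_derive_2 (a : nat -> R) (n : nat) :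
  PS_incr_1 (PS_derive (PS_derive a)) n = INR n * ((INR n + 1) * a (S n)).
Proof. rewrite PS_incr_derive. unfold PS_derive. now rewrite S_INR. Qed.

Lemma PS_incr_incr_derive_2 (a : nat -> R) (n : nat) :
  PS_incr_1 (PS_incr_1 (PS_derive (PS_derive a))) n = INR n * (INR n - 1) * a n.
Proof.
  destruct n as [|n]; [symmetry; rewrite !Rmult_0_l; reflexivity|].
  change (PS_incr_1 (PS_derive (PS_derive a)) n = INR (S n) * (INR (S n) - 1) * a (S n) :> R).
  rewrite PS_incr_derive_2, S_INR. ring.
Qed.

Lemma bounded_ipow (k : nat) : bounded_seq (fun n => ipow k n * ipow 2 n).
Proof.
  exists 1. intros n. pose proof (ipow_bound k n). pose proof (ipow_bound 2 n).
  rewrite Rabs_pos_eq; nra.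
Qed.

Lemma PSeries_combination (a b c d : nat -> R) (t : R) :
  ex_pseries a t -> ex_pseries b t -> ex_pseries c t -> ex_pseries d t ->
  4 * PSeries a t - PSeries b t + 2 * PSeries c t - PSeries d t =
  PSeries (fun n => 4 * a n - b n + 2 * c n - d n) t.
Proof.
  rewrite !ex_pseries_R. intros Ha Hb Hc Hd. symmetry. apply is_series_unique.
  apply Series_correct in Ha. apply Series_correct in Hb.
  apply Series_correct in Hc. apply Series_correct in Hd.
  pose proof (is_series_minus _ _ _ _
    (is_series_plus _ _ _ _ (is_series_minus _ _ _ _ (is_series_scal 4 _ _ Ha) Hb) (is_series_scal 2 _ _ Hc)) Hd) as H.
  revert H. apply is_series_ext. intros n.
  change (4 * (a n * t ^ n) - b n * t ^ n + 2 * (c n * t ^ n) - d n * t ^ n =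
          (4 * a n - b n + 2 * c n - d n) * t ^ n). ring.
Qed.

(** In the angle x, with t = 2 - 2 cos x, the second derivative of t^n is
    2n(2n-1) t^(n-1) - n^2 t^n.  The weights 1 / (n^2 C(2n,n)) make the resulting series
    telescope, leaving the differences of the coefficients. *)
Lemma is_derive_cbSeries' (c : nat -> R) (x : R) :
  bounded_seq (fun n => c n * ipow 2 n) -> c 0%nat = 0 -> 0 < cos x ->
  is_derive (cbSeries' c) x (PSeries (fun n => (c (S n) - c n) * cbinv n) (chord2 x)).
Proof.
  intros Hc Hc0 Hx. pose proof (CV_radius_cbcoef c x Hc Hx) as HCV.
  unfold cbSeries'. set (a := cbcoef c) in *.
  assert (HCV1 : Rbar_lt (Rabs (chord2 x)) (CV_radius (PS_derive a))) by now rewrite CV_radius_derive.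
  assert (HCV2 : Rbar_lt (Rabs (chord2 x)) (CV_radius (PS_derive (PS_derive a))))
    by now rewrite CV_radius_derive.
  evar_last.
  { apply (is_derive_mult (fun y => PSeries (PS_derive a) (chord2 y)) (fun y => 2 * sin y)).
    - apply is_derive_PSeries_chord2, HCV1.
    - auto_derive; [trivial|reflexivity].
    - intros; apply Rmult_comm. }
  unfold plus, mult; simpl.
  set (t := chord2 x) in *. set (P2 := PSeries (PS_derive (PS_derive a)) t).
  set (P1 := PSeries (PS_derive a) t).
  transitivity (4 * (t * P2) - t * (t * P2) + 2 * P1 - t * P1).
  { replace (cos x) with (1 - t / 2) by (unfold t, chord2; field).
    assert (Hs : sin x * sin x = t * (4 - t) / 4).
    { pose proof (sin2_cos2 x) as H. unfold Rsqr in H. unfold t, chord2.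
      replace (sin x * sin x) with (1 - cos x * cos x) by lra. field. }
    replace (P2 * (2 * sin x) * (2 * sin x)) with (4 * P2 * (sin x * sin x)) by ring.
    rewrite Hs. field. }
  unfold P1, P2.
  assert (HE1 : ex_pseries (PS_incr_1 (PS_derive a)) t)
    by apply ex_pseries_incr_1, CV_radius_inside, HCV1.
  assert (HE2 : ex_pseries (PS_incr_1 (PS_derive (PS_derive a))) t)
    by apply ex_pseries_incr_1, CV_radius_inside, HCV2.
  rewrite <- !PSeries_incr_1.
  rewrite PSeries_combination;
    [|exact HE2|apply ex_pseries_incr_1, HE2|apply CV_radius_inside, HCV1|exact HE1].
  apply PSeries_ext; intros n.
  change (4 * PS_incr_1 (PS_derive (PS_derive a)) n
          - PS_incr_1 (PS_incr_1 (PS_derive (PS_derive a))) n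
          + 2 * PS_derive a n - PS_incr_1 (PS_derive a) n = (c (S n) - c n) * cbinv n).
  rewrite PS_incr_derive_2, PS_incr_incr_derive_2, PS_incr_derive.
  unfold PS_derive, a, cbcoef. rewrite S_INR.
  transitivity (c (S n) * ((INR n + 1) * (4 * INR n + 2) * (ipow 2 (S n) * cbinv (S n)))
                - c n * (INR n * (INR n * ipow 2 n)) * cbinv n); [ring|].
  rewrite <- cbinv_S, INR_mul_ipow.
  destruct n as [|n]; [rewrite Hc0; ring|].
  rewrite ipow_1, Rinv_r by (apply not_0_INR; lia). ring.
Qed.

(** Multiplication by n is t d/dt, and dt/t = 2 d(log |1 - e^(ix)|). *)
Lemma is_derive_cbSeries_ipow (k : nat) (x : R) : 0 < x < PI / 2 ->
  is_derive (cbSeries (ipow (S k))) x (2 * (sin x / chord2 x) * cbSeries (ipow k) x).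
Proof.
  intros Hx. assert (Hc : 0 < cos x) by (apply cos_gt_0; lra).
  pose proof (one_minus_cos_pos x).
  evar_last; [apply is_derive_cbSeries; [apply bounded_ipow|exact Hc]|].
  unfold cbSeries', cbSeries.
  rewrite <- (PSeries_ext (PS_incr_1 (PS_derive (cbcoef (ipow (S k))))) (cbcoef (ipow k))).
  - rewrite PSeries_incr_1. field. unfold chord2. lra.
  - intros n. rewrite PS_incr_derive. unfold cbcoef.
    destruct n as [|n]; [rewrite !ipow_0; ring|].
    change (ipow (S k) (S n)) with (/ INR (S n) * ipow k (S n)).
    field. apply not_0_INR; lia.
Qed.

(** All differences of the coefficients vanish but the first, so the second derivative is 1.  The
    coefficient of index 0, which has weight 0 in [cbSeries], is set to 0 to give the right first
    difference. *)
Lemma cbSeries_ipow_0 (x : R) : 0 <= x < PI / 2 -> cbSeries (ipow 0) x = x ^ 2 / 2.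
Proof.
  intros Hx.
  set (c := fun n => match n with O => 0 | S _ => 1 end).
  assert (Hc : bounded_seq (fun n => c n * ipow 2 n)).
  { exists 1. intros n. pose proof (ipow_bound 2 n). unfold c. destruct n; rewrite Rabs_pos_eq; lra. }
  assert (Hcos : forall y, 0 <= y <= x -> 0 < cos y) by (intros; apply cos_gt_0; lra).
  assert (E0 : forall y, cbSeries (ipow 0) y = cbSeries c y).
  { intros y. apply PSeries_ext; intros n. unfold cbcoef.
    destruct n as [|n]; [rewrite ipow_0; ring|reflexivity]. }
  rewrite E0.
  assert (E2 : forall t, PSeries (fun n => (c (S n) - c n) * cbinv n) t = 1).
  { intros t. rewrite (PSeries_ext _ (fun n => match n with O => 1 | S _ => 0 end)).
    - apply is_series_unique. apply (filterlim_ext (fun _ => 1)); [|apply filterlim_const].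
      intros n; induction n as [|n IH]; [rewrite sum_O; simpl; ring|].
      rewrite sum_Sn, <- IH. unfold plus; simpl. ring.
    - intros n. unfold c. destruct n; [|ring].
      unfold cbinv, central_binomial, Binomial.C. simpl. field. }
  assert (H1 : forall y, 0 <= y <= x -> cbSeries' c y - y = 0).
  { intros y Hy.
    assert (Z : cbSeries' c 0 - 0 = 0) by (unfold cbSeries'; rewrite sin_0; ring).
    destruct (Req_dec y 0) as [->|Hy0]; [exact Z|]. rewrite <- Z.
    symmetry. apply (eq_is_derive (fun y => cbSeries' c y - y)); [|lra].
    intros t Ht. evar_last.
    - apply (is_derive_minus (K := R_AbsRing) (V := R_NormedModule)); [|apply is_derive_id].
      apply is_derive_cbSeries'; [exact Hc|reflexivity|apply Hcos; lra].
    - rewrite E2. apply Rminus_diag. }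
  assert (Z : cbSeries c 0 - 0 ^ 2 / 2 = 0).
  { unfold cbSeries, chord2. rewrite cos_0. replace (2 - 2 * 1) with 0 by ring.
    rewrite PSeries_0. unfold cbcoef, c. field. }
  destruct (Req_dec x 0) as [->|Hx0]; [lra|].
  assert (E : cbSeries c x - x ^ 2 / 2 = cbSeries c 0 - 0 ^ 2 / 2); [|lra].
  symmetry. apply (eq_is_derive (fun y => cbSeries c y - y ^ 2 / 2)); [|lra].
  intros t Ht. evar_last.
  - apply (is_derive_minus (K := R_AbsRing) (V := R_NormedModule)).
    + apply is_derive_cbSeries; [exact Hc|apply Hcos, Ht].
    + auto_derive; [trivial|reflexivity].
  - pose proof (H1 t Ht). unfold minus, plus, opp, zero; simpl. lra.
Qed.

Definition strict_harmonic3 (n : nat) : R := sum_f_R0 (ipow 3) (pred n).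

Lemma bounded_strict_harmonic3 : bounded_seq (fun n => strict_harmonic3 n * ipow 2 n).
Proof.
  assert (H : forall n, 0 <= sum_f_R0 (ipow 3) n <= INR n).
  { intros n; induction n as [|n IH]; simpl sum_f_R0.
    - rewrite ipow_0. simpl. lra.
    - pose proof (ipow_bound 3 (S n)). rewrite S_INR. lra. }
  exists 1. intros n. unfold strict_harmonic3.
  destruct n as [|n]; [rewrite (ipow_0 1), Rmult_0_r, Rabs_R0; lra|].
  pose proof (H n). simpl pred. pose proof (ipow_bound 2 (S n)).
  rewrite Rabs_pos_eq by nra.
  pose proof (INR_mul_ipow 0 (S n)) as E. pose proof (ipow_bound 1 (S n)).
  rewrite S_INR in E. nra.
Qed.

(** The differences 1/n^3 of the coefficients lower the order of the harmonic sum to 0. *)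
Lemma is_derive_cbSeries'_strict_harmonic3 (x : R) : 0 < cos x ->
  is_derive (cbSeries' strict_harmonic3) x (cbSeries (ipow 1) x).
Proof.
  intros Hx. evar_last.
  - apply is_derive_cbSeries'; [apply bounded_strict_harmonic3|apply ipow_0|exact Hx].
  - apply PSeries_ext; intros n. unfold cbcoef, strict_harmonic3. rewrite <- Rmult_assoc. f_equal.
    transitivity (ipow 3 n); [|unfold ipow; ring].
    destruct n as [|n]; [simpl; rewrite ipow_0; ring|simpl; ring].
Qed.

Lemma cbSeries_at_0 (c : nat -> R) : cbSeries c 0 = 0.
Proof.
  unfold cbSeries, chord2. rewrite cos_0. replace (2 - 2 * 1) with 0 by ring.
  rewrite PSeries_0. unfold cbcoef. rewrite ipow_0. ring.
Qed.

Lemma cbSeries_factor (c : nat -> R) :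
  bounded_seq (fun n => c n * ipow 2 n) ->
  exists d : R -> R, continuous d 0 /\ forall x, cbSeries c x = chord2 x * d x.
Proof.
  intros Hc. exists (fun x => PSeries (PS_decr_1 (cbcoef c)) (chord2 x)). split.
  - apply (continuous_comp chord2); [apply (ex_derive_continuous chord2); eexists; apply is_derive_chord2|].
    apply continuity_pt_filterlim, PSeries_continuity. rewrite CV_radius_decr_1.
    apply CV_radius_cbcoef; [exact Hc|]. rewrite cos_0; lra.
  - intros x. apply PSeries_decr_1_aux. unfold cbcoef. rewrite ipow_0. ring.
Qed.

(** * The circle |1 - z| = 1 *)

Lemma exp_logSin (x : R) : 0 < x < PI -> exp (logSin x) = 2 * sin (x / 2).
Proof.
  intros Hx. assert (Hs : 0 < sin (x / 2)) by (apply sin_gt_0; lra).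
  unfold logSin. replace (2 - 2 * cos x) with ((2 * sin (x / 2)) * (2 * sin (x / 2))).
  - rewrite ln_mult by lra.
    replace ((ln (2 * sin (x / 2)) + ln (2 * sin (x / 2))) / 2) with (ln (2 * sin (x / 2))) by field.
    apply exp_ln. lra.
  - replace (cos x) with (cos (2 * (x / 2))) by (f_equal; field). rewrite cos_2a_sin. ring.
Qed.

Lemma PI_bounds : 3 < PI <= 4.
Proof. pose proof PI2_3_2. pose proof PI_4. lra. Qed.

Lemma logSin_neg (x : R) : 0 < x < PI / 3 -> logSin x < 0.
Proof.
  intros Hx. apply exp_lt_inv. rewrite exp_0, exp_logSin by lra.
  assert (sin (x / 2) < sin (PI / 6)) by (apply sin_increasing_1; lra).
  rewrite sin_PI6 in *. lra.
Qed.

Lemma is_derive_logSin (x : R) : 0 < x < 2 * PI -> is_derive logSin x (sin x / chord2 x).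
Proof.
  intros Hx. pose proof (one_minus_cos_pos x Hx).
  unfold logSin, chord2. auto_derive; [lra|]. field. lra.
Qed.

Lemma is_derive_sawtooth (x : R) : is_derive sawtooth x (- / 2).
Proof. unfold sawtooth. auto_derive; [trivial|field]. Qed.

(** The circle is parametrized by z = 1 - e^(-ix) = e^(L + is), with L = [logSin x] and
    s = [sawtooth x], so that -log(1 - z) = ix. *)
Lemma logRe_circle (x : R) : 0 < x < PI / 3 -> logRe (exp (logSin x)) (sawtooth x) = 0.
Proof.
  intros Hx. rewrite exp_logSin by lra. unfold logRe, sawtooth.
  replace ((PI - x) / 2) with (PI / 2 - x / 2) by field. rewrite cos_shift.
  replace (1 - 2 * (2 * sin (x / 2)) * sin (x / 2) + (2 * sin (x / 2)) ^ 2) with 1 by ring.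
  rewrite ln_1. field.
Qed.

(** With y = s/2, the argument of the arctangent is - cot(3y). *)
Lemma logIm_circle (x : R) : 0 < x < PI / 3 -> logIm (exp (logSin x)) (sawtooth x) = x.
Proof.
  intros Hx. rewrite exp_logSin by lra. unfold logIm.
  set (y := sawtooth x / 2).
  assert (Hy : PI / 6 < y < PI / 4) by (unfold y, sawtooth; lra).
  assert (Hs : 0 < sin y) by (apply sin_gt_0; lra).
  assert (Er : sin (x / 2) = 1 - 2 * (sin y * sin y)).
  { rewrite <- cos_shift. replace (PI / 2 - x / 2) with (2 * y) by (unfold y, sawtooth; field).
    rewrite cos_2a_sin. ring. }
  assert (Hr : 0 < sin (x / 2)) by (apply sin_gt_0; lra).
  assert (Ea : (1 - 2 * sin (x / 2)) / (1 + 2 * sin (x / 2)) *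
               (sin (sawtooth x) / (1 - cos (sawtooth x))) = tan (3 * y - PI / 2)).
  { replace (sawtooth x) with (2 * y) by (unfold y; field).
    unfold tan. replace (3 * y - PI / 2) with (- (PI / 2 - (2 * y + y))) by ring.
    rewrite sin_neg, cos_neg, sin_shift, cos_shift, sin_plus, cos_plus, sin_2a, cos_2a_sin, Er.
    rewrite Er in Hr.
    pose proof (sin2_cos2 y) as E1. unfold Rsqr in E1.
    set (s := sin y) in *. set (c := cos y) in *.
    replace (2 * s * c * c + (1 - 2 * s * s) * s) with (s * (3 - 4 * (s * s))).
    2: { replace (2 * s * c * c) with (2 * s * (c * c)) by ring.
         replace (c * c) with (1 - s * s) by lra. ring. }
    replace ((1 - 2 * s * s) * c - 2 * s * c * s) with (c * (1 - 4 * (s * s))) by ring.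
    field. repeat split; nra. }
  rewrite Ea, atan_tan by lra. unfold y, sawtooth. field.
Qed.

(** Real part of the primitive z^n (a^2/n - 2a/n^2 + 2/n^3) of z^(n-1) a^2, with
    a = log z = L + iS, times the coefficient of z^n in log(1 - z)^2. *)
Definition circleTerm (n : nat) (x : R) : R :=
  let L := logSin x in
  let S := sawtooth x in
  logSq n * (exp (INR n * L) *
    (cos (INR n * S) * ((L ^ 2 - S ^ 2) * ipow 1 n - 2 * L * ipow 2 n + 2 * ipow 3 n)
     - sin (INR n * S) * (2 * L * S * ipow 1 n - 2 * S * ipow 2 n))).

Definition circleSeries (x : R) : R := Series (fun n => circleTerm n x).

(** Real and imaginary parts of a^2 a'. *)
Definition circleRe (x : R) : R :=
  (logSin x ^ 2 - sawtooth x ^ 2) * (sin x / chord2 x) + logSin x * sawtooth x.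

Definition circleIm (x : R) : R :=
  2 * logSin x * sawtooth x * (sin x / chord2 x) - (logSin x ^ 2 - sawtooth x ^ 2) / 2.

Lemma is_derive_circleTerm (n : nat) (x : R) : 0 < x < 2 * PI ->
  is_derive (circleTerm n) x
    (logSq n * (exp (INR n * logSin x) *
      (cos (INR n * sawtooth x) * circleRe x - sin (INR n * sawtooth x) * circleIm x))).
Proof.
  intros Hx. destruct n as [|n].
  { rewrite logSq_0, Rmult_0_l. apply (is_derive_ext (fun _ => 0)).
    - intros t. unfold circleTerm. rewrite logSq_0. symmetry. apply Rmult_0_l.
    - apply (is_derive_const (K := R_AbsRing) (V := R_NormedModule)). }
  pose proof (is_derive_logSin x Hx) as HL. pose proof (is_derive_sawtooth x) as HS.
  unfold circleTerm, circleRe, circleIm, ipow.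
  assert (HN : INR (S n) <> 0) by (apply not_0_INR; lia).
  set (N := INR (S n)) in *. set (w := logSq (S n)). set (d := sin x / chord2 x) in *.
  cbv zeta.
  auto_derive.
  - repeat split; try (eexists; eassumption).
  - assert (EL : Derive (fun y : R => logSin y) x = d) by apply is_derive_unique, HL.
    assert (ES : Derive (fun y : R => sawtooth y) x = - / 2) by apply is_derive_unique, HS.
    rewrite EL, ES. field. exact HN.
Qed.

Lemma exp_INR_mult (n : nat) (y : R) : exp (INR n * y) = exp y ^ n.
Proof.
  induction n as [|n IH]; [simpl; rewrite Rmult_0_l; apply exp_0|].
  rewrite S_INR, Rmult_plus_distr_r, Rmult_1_l, exp_plus, IH. simpl. ring.
Qed.

(** The exponential beats the powers of the logarithm; this needs n >= 2, and the first
    nonzero coefficient of log(1 - z)^2 is that of z^2. *)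
Lemma circleTerm_bound (n : nat) (x : R) : 0 < x < PI / 3 ->
  Rabs (circleTerm n x) <= logSq n * ipow 1 n * (10 * exp (logSin x)).
Proof.
  intros Hx. destruct n as [|[|n]].
  1, 2: unfold circleTerm; rewrite ?logSq_0, ?logSq_1, !Rmult_0_l, Rabs_R0; lra.
  pose proof (logSin_neg x Hx) as HL. pose proof PI_bounds as HPI.
  assert (HS : 0 <= sawtooth x <= 2) by (unfold sawtooth; lra).
  unfold circleTerm. set (L := logSin x) in *. set (S := sawtooth x) in *. cbv zeta.
  set (m := Datatypes.S (Datatypes.S n)).
  assert (HE : exp (INR m * L) <= exp L * exp L).
  { rewrite <- exp_plus. assert (2 <= INR m) by (unfold m; rewrite !S_INR; pose proof (pos_INR n); lra).
    destruct (Rle_lt_or_eq (INR m * L) (L + L)) as [Hlt| ->]; [nra| |lra].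
    left. apply exp_increasing, Hlt. }
  pose proof (exp_pos (INR m * L)) as HE0. pose proof (exp_pos L) as HE1.
  pose proof (ipow_bound 1 m) as H1.
  assert (H2 := conj (proj1 (ipow_bound 2 m)) (ipow_decr 1 m)).
  assert (H3 := conj (proj1 (ipow_bound 3 m)) (Rle_trans _ _ _ (ipow_decr 2 m) (ipow_decr 1 m))).
  set (i1 := ipow 1 m) in *. set (i2 := ipow 2 m) in *. set (i3 := ipow 3 m) in *.
  assert (HC := cos_Rabs_le (INR m * S)). assert (HD := sin_Rabs_le (INR m * S)).
  set (c := cos (INR m * S)) in *. set (d := sin (INR m * S)) in *.
  rewrite Rabs_mult, (Rabs_pos_eq (logSq m)) by apply logSq_bound.
  rewrite (Rmult_assoc (logSq m) i1). apply Rmult_le_compat_l; [apply logSq_bound|].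
  rewrite Rabs_mult, (Rabs_pos_eq (exp _)) by lra.
  assert (P1 : 0 <= - L * i2 <= - L * i1) by (split; [apply Rmult_le_pos|apply Rmult_le_compat_l]; lra).
  assert (P2 : 0 <= S * i2 <= 2 * i1) by (split; [apply Rmult_le_pos|apply Rmult_le_compat]; lra).
  assert (P3 : 0 <= S ^ 2 * i1 <= 4 * i1)
    by (split; [apply Rmult_le_pos|apply Rmult_le_compat_r]; nra).
  assert (P4 : 0 <= L ^ 2 * i1) by (apply Rmult_le_pos; nra).
  assert (P5 : 0 <= - L * i1 * S <= - L * i1 * 2) by (split; [apply Rmult_le_pos|apply Rmult_le_compat_l]; lra).
  assert (HA : Rabs ((L ^ 2 - S ^ 2) * i1 - 2 * L * i2 + 2 * i3) <= i1 * (L ^ 2 + 4 - 2 * L + 2)).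
  { apply Rabs_le. split; lra. }
  assert (HB : Rabs (2 * L * S * i1 - 2 * S * i2) <= i1 * (4 - 4 * L)).
  { apply Rabs_le. split; lra. }
  assert (HT : Rabs (c * ((L ^ 2 - S ^ 2) * i1 - 2 * L * i2 + 2 * i3) -
     d * (2 * L * S * i1 - 2 * S * i2)) <= i1 * (L ^ 2 - 6 * L + 10)).
  { eapply Rle_trans; [apply Rabs_triang|]. rewrite Rabs_Ropp, !Rabs_mult.
    pose proof (Rabs_pos ((L ^ 2 - S ^ 2) * i1 - 2 * L * i2 + 2 * i3)).
    pose proof (Rabs_pos (2 * L * S * i1 - 2 * S * i2)). nra. }
  assert (HX : exp L * (L ^ 2 - 6 * L + 10) <= 10).
  { assert (E : exp L * (exp (- L / 2) * exp (- L / 2)) = 1).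
    { rewrite <- !exp_plus. rewrite <- exp_0. f_equal. field. }
    pose proof (exp_ineq1_le (- L / 2)).
    assert ((1 - L / 2) * (1 - L / 2) <= exp (- L / 2) * exp (- L / 2)) by (apply Rmult_le_compat; lra).
    assert (L ^ 2 - 6 * L + 10 <= 10 * (exp (- L / 2) * exp (- L / 2))) by nra.
    rewrite <- (Rmult_1_r 10), <- E. nra. }
  apply Rle_trans with (exp L * exp L * (i1 * (L ^ 2 - 6 * L + 10))).
  { apply Rmult_le_compat; try lra. apply Rabs_pos. }
  replace (exp L * exp L * (i1 * (L ^ 2 - 6 * L + 10)))
    with (i1 * exp L * (exp L * (L ^ 2 - 6 * L + 10))) by ring.
  replace (i1 * (10 * exp L)) with (i1 * exp L * 10) by ring.
  apply Rmult_le_compat_l; [apply Rmult_le_pos; lra|exact HX].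
Qed.

Lemma ex_series_circle_majorant (K : R) : ex_series (fun n => logSq n * ipow 1 n * K).
Proof.
  apply (ex_series_scal_r K), ex_series_logSq.
Qed.

Lemma locally_Rabs_le (f : R -> R) (x : R) : continuous f x ->
  locally x (fun y => Rabs (f y) <= Rabs (f x) + 1).
Proof.
  intros H. pose proof (proj1 (filterlim_locally _ _) H (mkposreal 1 Rlt_0_1)) as H'.
  revert H'; apply filter_imp; intros y Hy.
  change (Rabs (f y - f x) < 1) in Hy.
  replace (f y) with (f x + (f y - f x)) by ring.
  pose proof (Rabs_triang (f x) (f y - f x)). lra.
Qed.

(** Along this circle log(1 - z)^2 = - x^2, so that summing the derivatives gives the real part of
    - x^2 a^2 a'. *)
Lemma is_derive_circleSeries (x : R) : 0 < x < PI / 3 ->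
  is_derive circleSeries x (- x ^ 2 * circleRe x).
Proof.
  intros Hx.
  pose proof (logSin_neg x Hx) as HL0. pose proof (exp_pos (logSin x)) as HE0.
  assert (HE1 : exp (logSin x) < 1) by (rewrite <- exp_0; apply exp_increasing, HL0).
  pose proof (one_minus_cos_pos x) as Hc.
  replace (- x ^ 2 * circleRe x) with (Series (fun n => logSq n * (exp (INR n * logSin x) *
      (cos (INR n * sawtooth x) * circleRe x - sin (INR n * sawtooth x) * circleIm x)))).
  2: { assert (HS : 0 < sawtooth x < 2 * PI) by (unfold sawtooth; lra).
       pose proof (logSq_cos_series (exp (logSin x)) (sawtooth x) HS ltac:(lra)) as E1.
       pose proof (logSq_sin_series (exp (logSin x)) (sawtooth x) HS ltac:(lra)) as E2.
       rewrite logRe_circle, logIm_circle in E1, E2 by exact Hx.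
       assert (Hex : forall f, (forall y, Rabs (f y) <= 1) ->
         ex_series (fun n => logSq n * (exp (logSin x) ^ n * f (INR n * sawtooth x)))).
       { intros f Hf. apply ex_series_dominated with (fun n => 2 * exp (logSin x) ^ n).
         - intros n. pose proof (logSq_bound n). pose proof (pow_lt _ n HE0).
           rewrite !Rabs_mult, (Rabs_pos_eq (logSq n)), (Rabs_pos_eq (exp (logSin x) ^ n)) by lra.
           apply Rmult_le_compat; try lra.
           + apply Rmult_le_pos; [lra|apply Rabs_pos].
           + rewrite <- (Rmult_1_r (exp (logSin x) ^ n)) at 2. apply Rmult_le_compat_l; auto; lra.
         - apply (ex_series_scal_l (K := R_AbsRing) (V := R_NormedModule)), ex_series_geom.
           rewrite Rabs_pos_eq; lra. }
       rewrite (Series_ext _ (fun n =>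
          logSq n * (exp (logSin x) ^ n * cos (INR n * sawtooth x)) * circleRe x -
          logSq n * (exp (logSin x) ^ n * sin (INR n * sawtooth x)) * circleIm x)).
       - rewrite Series_minus, !Series_scal_r, E1, E2; [ring| |].
         + apply ex_series_scal_r, Hex, cos_Rabs_le.
         + apply ex_series_scal_r, Hex, sin_Rabs_le.
       - intros n. rewrite exp_INR_mult. ring. }
  (* any ratio strictly between |z| and 1 *)
  set (q := (exp (logSin x) + 1) / 2).
  assert (HcL : continuous (fun y => exp (logSin y)) x).
  { apply (ex_derive_continuous (fun y => exp (logSin y))). unfold logSin. auto_derive. lra. }
  assert (HcR : continuous circleRe x).
  { apply (ex_derive_continuous circleRe). unfold circleRe, logSin, sawtooth, chord2.
    auto_derive. repeat split; lra. }
  assert (HcI : continuous circleIm x).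
  { apply (ex_derive_continuous circleIm). unfold circleIm, logSin, sawtooth, chord2.
    auto_derive. repeat split; lra. }
  assert (Hq : locally x (fun y => exp (logSin y) < q)).
  { apply (HcL (fun z => z < q)). apply (open_lt q). unfold q; lra. }
  set (K := Rabs (circleRe x) + 1 + (Rabs (circleIm x) + 1)).
  apply (is_derive_Series circleTerm
    (fun n x => logSq n * (exp (INR n * logSin x) *
      (cos (INR n * sawtooth x) * circleRe x - sin (INR n * sawtooth x) * circleIm x)))
    (fun n => 2 * K * q ^ n)).
  - apply (ex_series_scal_l (K := R_AbsRing) (V := R_NormedModule)), ex_series_geom.
    rewrite Rabs_pos_eq; unfold q; lra.
  - generalize (filter_and _ _ (filter_and _ _ (locally_between _ _ _ Hx) Hq)
      (filter_and _ _ (locally_Rabs_le _ _ HcR) (locally_Rabs_le _ _ HcI))).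
    apply filter_imp; intros y [[Hy Hqy] [HR HI]] n.
    split; [apply is_derive_circleTerm; lra|].
    pose proof (exp_pos (logSin y)). rewrite exp_INR_mult.
    pose proof (logSq_bound n). pose proof (pow_lt (exp (logSin y)) n ltac:(lra)).
    assert (exp (logSin y) ^ n <= q ^ n) by (apply pow_incr; lra).
    assert (HT : Rabs (cos (INR n * sawtooth y) * circleRe y - sin (INR n * sawtooth y) * circleIm y) <= K).
    { eapply Rle_trans; [apply Rabs_triang|]. rewrite Rabs_Ropp, !Rabs_mult.
      pose proof (cos_Rabs_le (INR n * sawtooth y)). pose proof (sin_Rabs_le (INR n * sawtooth y)).
      pose proof (Rabs_pos (circleRe y)). pose proof (Rabs_pos (circleIm y)).
      unfold K. nra. }
    rewrite !Rabs_mult, (Rabs_pos_eq (logSq n)), (Rabs_pos_eq (exp (logSin y) ^ n)) by lra.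
    replace (2 * K * q ^ n) with (2 * (q ^ n * K)) by ring.
    apply Rmult_le_compat; try lra.
    + apply Rmult_le_pos; [lra|apply Rabs_pos].
    + apply Rmult_le_compat; try lra. apply Rabs_pos.
  - generalize (locally_between _ _ _ Hx). apply filter_imp; intros y Hy.
    apply ex_series_dominated with (2 := ex_series_circle_majorant (10 * exp (logSin y))).
    intros n. apply circleTerm_bound, Hy.
Qed.

Lemma at_right_interval (a b : R) : a < b -> at_right a (fun y => a < y < b).
Proof.
  intros H. exists (mkposreal (b - a) (proj2 (Rlt_0_minus _ _) H)). intros y Hy Hlt.
  change (Rabs (y - a) < b - a) in Hy. apply Rabs_def2 in Hy. lra.
Qed.

Lemma at_left_interval (a b : R) : a < b -> at_left b (fun y => a < y < b).
Proof.
  intros H. exists (mkposreal (b - a) (proj2 (Rlt_0_minus _ _) H)). intros y Hy Hlt.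
  change (Rabs (y - b) < b - a) in Hy. apply Rabs_def2 in Hy. lra.
Qed.

Lemma filterlim_continuous_at_right (f : R -> R) (x : R) :
  continuous f x -> filterlim f (at_right x) (locally (f x)).
Proof.
  intros H. refine (filterlim_filter_le_1 (F := locally x) (G := at_right x) _ _ H).
  intros P HP. unfold at_right, within. revert HP; apply filter_imp; auto.
Qed.

Lemma filterlim_continuous_at_left (f : R -> R) (x : R) :
  continuous f x -> filterlim f (at_left x) (locally (f x)).
Proof.
  intros H. refine (filterlim_filter_le_1 (F := locally x) (G := at_left x) _ _ H).
  intros P HP. unfold at_left, within. revert HP; apply filter_imp; auto.
Qed.

Lemma filterlim_exp_logSin_0 : filterlim (fun x => exp (logSin x)) (at_right 0) (locally 0).
Proof.
  pose proof PI_bounds.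
  apply filterlim_ext_loc with (fun x => 2 * sin (x / 2)).
  - generalize (at_right_interval 0 PI ltac:(lra)). apply filter_imp; intros y Hy.
    now rewrite exp_logSin.
  - assert (E : 2 * sin (0 / 2) = 0) by (unfold Rdiv; rewrite Rmult_0_l, sin_0; ring).
    rewrite <- E at 2.
    apply (filterlim_continuous_at_right (fun x => 2 * sin (x / 2))).
    apply (ex_derive_continuous (fun x => 2 * sin (x / 2))).
    auto_derive. trivial.
Qed.

Lemma filterlim_squeeze_0 {T : Type} {F : (T -> Prop) -> Prop} {FF : Filter F} (f g : T -> R) :
  F (fun x => Rabs (f x) <= g x) -> filterlim g F (locally 0) -> filterlim f F (locally 0).
Proof.
  intros Hfg Hg. apply filterlim_locally; intros eps.
  pose proof (proj1 (filterlim_locally _ _) Hg eps) as H.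
  generalize (filter_and _ _ Hfg H). apply filter_imp; intros x [H1 H2].
  change (Rabs (g x - 0) < eps) in H2. change (Rabs (f x - 0) < eps).
  rewrite Rminus_0_r in *. pose proof (Rle_abs (g x)). lra.
Qed.

Lemma circleSeries_limit_0 : filterlim circleSeries (at_right 0) (locally 0).
Proof.
  pose proof PI_bounds.
  apply filterlim_squeeze_0 with
    (fun x => Series (fun n => logSq n * ipow 1 n) * (10 * exp (logSin x))).
  - generalize (at_right_interval 0 (PI / 3) ltac:(lra)). apply filter_imp; intros y Hy.
    rewrite <- Series_scal_r. apply Series_Rabs_le.
    + intros n. apply circleTerm_bound, Hy.
    + apply ex_series_circle_majorant.
  - replace 0 with (Series (fun n => logSq n * ipow 1 n) * (10 * 0)) at 2 by ring.
    apply filterlim_Rmult; [apply filterlim_const|].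
    apply filterlim_Rmult; [apply filterlim_const|apply filterlim_exp_logSin_0].
Qed.

(** The real part of the same primitive on the unit circle, where a = ix. *)
Definition arcSeries (x : R) : R :=
  - x ^ 2 * cosSeries (fun n => logSq n * ipow 1 n) x
  + 2 * x * sinSeries (fun n => logSq n * ipow 2 n) x
  + 2 * cosSeries (fun n => logSq n * ipow 3 n) x.

Lemma logSin_PI3 : logSin (PI / 3) = 0.
Proof.
  unfold logSin. rewrite cos_PI3. replace (2 - 2 * (1 / 2)) with 1 by field. rewrite ln_1. field.
Qed.

(** The two circles meet at the sixth root of unity. *)
Lemma circleSeries_PI3 :
  Series (fun n => circleTerm n (PI / 3)) = arcSeries (PI / 3).
Proof.
  assert (Hex : forall k f, (forall y, Rabs (f y) <= 1) ->
    ex_series (fun n => logSq n * ipow (S k) n * f (INR n * (PI / 3)))).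
  { intros k f Hf. apply ex_series_dominated with (2 := ex_series_logSq k).
    intros n. pose proof (logSq_bound n). pose proof (ipow_bound (S k) n).
    assert (0 <= logSq n * ipow (S k) n) by (apply Rmult_le_pos; lra).
    rewrite Rabs_mult, (Rabs_pos_eq (logSq n * ipow (S k) n)) by lra.
    rewrite <- (Rmult_1_r (logSq n * ipow (S k) n)) at 2. apply Rmult_le_compat_l; auto. }
  unfold arcSeries, trigSeries.
  rewrite <- !Series_scal_l.
  assert (H1 := Hex 0%nat cos cos_Rabs_le). assert (H2 := Hex 1%nat sin sin_Rabs_le).
  assert (H3 := Hex 2%nat cos cos_Rabs_le).
  rewrite <- Series_plus.
  - rewrite <- Series_plus.
    + apply Series_ext; intros n. unfold circleTerm. cbv zeta. rewrite logSin_PI3, Rmult_0_r, exp_0.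
      replace (sawtooth (PI / 3)) with (PI / 3) by (unfold sawtooth; field). ring.
    + apply (ex_series_plus (K := R_AbsRing) (V := R_NormedModule));
        apply (ex_series_scal_l (K := R_AbsRing) (V := R_NormedModule)); assumption.
    + apply (ex_series_scal_l (K := R_AbsRing) (V := R_NormedModule)); assumption.
  - apply (ex_series_scal_l (K := R_AbsRing) (V := R_NormedModule)); assumption.
  - apply (ex_series_scal_l (K := R_AbsRing) (V := R_NormedModule)); assumption.
Qed.

Lemma circleSeries_limit_PI3 :
  filterlim circleSeries (at_left (PI / 3)) (locally (arcSeries (PI / 3))).
Proof.
  pose proof PI_bounds. rewrite <- circleSeries_PI3.
  apply (filterlim_Series (F := at_left (PI / 3)) circleTerm _ _ (ex_series_circle_majorant 10)).
  - generalize (at_left_interval 0 (PI / 3) ltac:(lra)). apply filter_imp; intros y Hy n.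
    eapply Rle_trans; [apply circleTerm_bound, Hy|].
    assert (exp (logSin y) < 1) by (rewrite <- exp_0; apply exp_increasing, logSin_neg, Hy).
    pose proof (exp_pos (logSin y)).
    apply Rmult_le_compat_l; [|lra].
    apply Rmult_le_pos; [apply logSq_bound|apply ipow_bound].
  - intros n. apply filterlim_continuous_at_left.
    apply (ex_derive_continuous (circleTerm n)). eexists. apply is_derive_circleTerm. lra.
Qed.

Lemma is_derive_arcSeries (x : R) : 0 < x < 2 * PI ->
  is_derive arcSeries x (- 2 * x ^ 2 * logSin x * sawtooth x).
Proof.
  intros Hx.
  pose proof (is_derive_cosSeries_logSq x Hx) as H1.
  assert (H2 : is_derive (sinSeries (fun n => logSq n * ipow 2 n)) x (cosSeries (fun n => logSq n * ipow 1 n) x))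
    by (apply is_derive_sinSeries; auto using ex_series_Rabs_logSq, INR_mul_logSq).
  assert (H3 : is_derive (cosSeries (fun n => logSq n * ipow 3 n)) x (- sinSeries (fun n => logSq n * ipow 2 n) x))
    by (apply is_derive_cosSeries; auto using ex_series_Rabs_logSq, INR_mul_logSq).
  unfold arcSeries.
  set (f1 := cosSeries (fun n => logSq n * ipow 1 n)) in *.
  set (f2 := sinSeries (fun n => logSq n * ipow 2 n)) in *.
  set (f3 := cosSeries (fun n => logSq n * ipow 3 n)) in *.
  auto_derive.
  - repeat split; eexists; eassumption.
  - assert (E1 : Derive (fun y : R => f1 y) x = _) by apply is_derive_unique, H1.
    assert (E2 : Derive (fun y : R => f2 y) x = _) by apply is_derive_unique, H2.
    assert (E3 : Derive (fun y : R => f3 y) x = _) by apply is_derive_unique, H3.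
    rewrite E1, E2, E3. ring.
Qed.

Lemma continuous_arcSeries (x : R) : continuous arcSeries x.
Proof.
  pose proof (continuous_cosSeries _ x (ex_series_Rabs_logSq 0)) as H1.
  pose proof (continuous_sinSeries _ x (ex_series_Rabs_logSq 1)) as H2.
  pose proof (continuous_cosSeries _ x (ex_series_Rabs_logSq 2)) as H3.
  unfold arcSeries. apply continuous_Rplus; [apply continuous_Rplus|]; apply continuous_Rmult;
    try assumption; apply (ex_derive_continuous (V := R_NormedModule)); auto_derive; trivial.
Qed.

(** * Zeta values *)

Definition multiple (d n : nat) : R := if Nat.eqb (n mod d) 0 then 1 else 0.

(** The partial sums up to d N are those of the subsequence of multiples of d. *)
Lemma Series_multiples (d s : nat) : (0 < d)%nat ->
  is_series (fun n => multiple d n * ipow (S (S s)) n)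
    ((/ INR d) ^ S (S s) * Series (ipow (S (S s)))).
Proof.
  intros Hd. set (f := fun n => multiple d n * ipow (S (S s)) n).
  assert (Hex : ex_series f).
  { apply ex_series_dominated with (2 := ex_series_ipow s). intros n. unfold f, multiple.
    pose proof (ipow_bound (S (S s)) n). destruct (Nat.eqb _ _); rewrite Rabs_pos_eq; lra. }
  assert (Hpart : forall N, sum_n f (d * N) = sum_n (fun k => f (d * k)%nat) N).
  { intros N; induction N as [|N IH].
    - rewrite Nat.mul_0_r, !sum_O. now rewrite Nat.mul_0_r.
    - assert (Hj : forall j, (j < d)%nat -> sum_n f (d * N + j) = sum_n f (d * N)).
      { intros j; induction j as [|j IHj]; intros Hlt; [now rewrite Nat.add_0_r|].
        rewrite Nat.add_succ_r, sum_Sn, IHj by lia.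
        unfold f at 2, multiple. rewrite <- Nat.add_succ_r, Nat.mul_comm, Nat.add_comm, Nat.Div0.mod_add.
        rewrite Nat.mod_small by lia. simpl Nat.eqb. unfold plus; simpl. ring. }
      rewrite sum_Sn, <- IH, <- (Hj (pred d)) by lia.
      replace (d * S N)%nat with (S (d * N + pred d)) by lia.
      rewrite sum_Sn. reflexivity. }
  assert (Hval : forall k, f (d * k)%nat = (/ INR d) ^ S (S s) * ipow (S (S s)) k).
  { intros k. unfold f, multiple. rewrite Nat.mul_comm, Nat.Div0.mod_mul. simpl Nat.eqb.
    unfold ipow. rewrite mult_INR, Rinv_mult, Rpow_mult_distr. ring. }
  replace ((/ INR d) ^ S (S s) * Series (ipow (S (S s)))) with (Series f).
  { apply Series_correct, Hex. }
  rewrite <- Series_scal_l, <- (Series_ext _ _ Hval).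
  symmetry. apply is_series_unique.
  apply (filterlim_ext (fun N => sum_n f (d * N)) _ Hpart).
  eapply filterlim_comp; [|apply (Series_correct _ Hex)].
  intros P [N HN]. exists N. intros n Hn. apply HN. nia.
Qed.

Lemma cos_sixth (n : nat) :
  cos (INR n * (PI / 3)) = 1 / 2 - multiple 2 n - 3 / 2 * multiple 3 n + 3 * multiple 6 n.
Proof.
  rewrite (Nat.div_mod_eq n 6) at 1. rewrite plus_INR, mult_INR.
  set (q := (n / 6)%nat).
  assert (Hr : (n mod 6 < 6)%nat) by (apply Nat.mod_upper_bound; lia).
  replace ((INR 6 * INR q + INR (n mod 6)) * (PI / 3)) with (INR (n mod 6) * (PI / 3) + 2 * INR q * PI)
    by (simpl (INR 6); field).
  rewrite cos_period. unfold multiple.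
  assert (E2 : (n mod 2 = (n mod 6) mod 2)%nat).
  { rewrite (Nat.div_mod_eq n 6) at 1. fold q.
    replace (6 * q + n mod 6)%nat with (n mod 6 + (3 * q) * 2)%nat by lia. apply Nat.Div0.mod_add. }
  assert (E3 : (n mod 3 = (n mod 6) mod 3)%nat).
  { rewrite (Nat.div_mod_eq n 6) at 1. fold q.
    replace (6 * q + n mod 6)%nat with (n mod 6 + (2 * q) * 3)%nat by lia. apply Nat.Div0.mod_add. }
  rewrite E2, E3.
  assert (C1 : cos (2 * (PI / 3)) = - (1 / 2)).
  { rewrite cos_2a_cos, cos_PI3. field. }
  destruct (n mod 6)%nat as [|[|[|[|[|[|k]]]]]]; [| | | | | |lia]; cbn -[INR cos];
    rewrite ?INR_0, ?INR_1.
  - rewrite Rmult_0_l, cos_0. field.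
  - rewrite Rmult_1_l, cos_PI3. field.
  - simpl INR. replace ((1 + 1) * (PI / 3)) with (2 * (PI / 3)) by ring. rewrite C1. field.
  - simpl INR. replace ((1 + 1 + 1) * (PI / 3)) with PI by field. rewrite cos_PI. field.
  - simpl INR. replace ((1 + 1 + 1 + 1) * (PI / 3)) with (PI / 3 + PI) by field.
    rewrite neg_cos, cos_PI3. field.
  - simpl INR. replace ((1 + 1 + 1 + 1 + 1) * (PI / 3)) with (2 * (PI / 3) + PI) by field.
    rewrite neg_cos, C1. field.
Qed.

Lemma cos_half (n : nat) : cos (INR n * PI) = -1 + 2 * multiple 2 n.
Proof.
  unfold multiple. induction n as [|n IH].
  - simpl. rewrite Rmult_0_l, cos_0. ring.
  - rewrite S_INR, Rmult_plus_distr_r, Rmult_1_l, neg_cos, IH.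
    replace (S n) with (n + 1)%nat by lia.
    rewrite <- (Nat.Div0.add_mod_idemp_l n 1 2).
    destruct (n mod 2)%nat as [|[|k]] eqn:E; simpl; try ring.
    pose proof (Nat.mod_upper_bound n 2). lia.
Qed.

Lemma cosSeries_PI3 (s : nat) :
  cosSeries (ipow (S (S s))) (PI / 3) =
  (1 / 2 - (/ 2) ^ S (S s) - 3 / 2 * (/ 3) ^ S (S s) + 3 * (/ 6) ^ S (S s)) * Series (ipow (S (S s))).
Proof.
  pose proof (Series_correct _ (ex_series_ipow s)) as H1.
  pose proof (Series_multiples 2 s ltac:(lia)) as H2.
  pose proof (Series_multiples 3 s ltac:(lia)) as H3.
  pose proof (Series_multiples 6 s ltac:(lia)) as H6.
  apply is_series_unique.
  pose proof (is_series_plus _ _ _ _ (is_series_minus _ _ _ _ (is_series_minus _ _ _ _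
    (is_series_scal (1 / 2) _ _ H1) H2) (is_series_scal (3 / 2) _ _ H3)) (is_series_scal 3 _ _ H6)) as H.
  replace (INR 2) with 2 in H by (simpl; ring). replace (INR 3) with 3 in H by (simpl; ring).
  replace (INR 6) with 6 in H by (simpl; ring).
  match type of H with is_series _ ?l => match goal with |- is_series _ ?m => replace m with l end end.
  2: { unfold plus, opp, scal; simpl; unfold mult; simpl. ring. }
  revert H. apply is_series_ext. intros n. rewrite cos_sixth.
  unfold plus, opp, scal; simpl; unfold mult; simpl. ring.
Qed.

Lemma cosSeries_PI (s : nat) :
  cosSeries (ipow (S (S s))) PI = (-1 + 2 * (/ 2) ^ S (S s)) * Series (ipow (S (S s))).
Proof.
  pose proof (Series_correct _ (ex_series_ipow s)) as H1.
  pose proof (Series_multiples 2 s ltac:(lia)) as H2.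
  apply is_series_unique.
  pose proof (is_series_plus _ _ _ _ (is_series_scal (-1) _ _ H1) (is_series_scal 2 _ _ H2)) as H.
  replace (INR 2) with 2 in H by (simpl; ring).
  match type of H with is_series _ ?l => match goal with |- is_series _ ?m => replace m with l end end.
  2: { unfold plus, opp, scal; simpl; unfold mult; simpl. ring. }
  revert H. apply is_series_ext. intros n. rewrite cos_half.
  unfold plus, opp, scal; simpl; unfold mult; simpl. ring.
Qed.

(** Basel: integrate the sawtooth from pi/3 to pi. *)
Lemma zeta_2 : zeta 2 = PI ^ 2 / 6.
Proof.
  rewrite zeta_ipow. pose proof PI_bounds.
  assert (E : cosSeries (ipow 2) (PI / 3) + (PI * (PI / 3) / 2 - (PI / 3) ^ 2 / 4) =
              cosSeries (ipow 2) PI + (PI * PI / 2 - PI ^ 2 / 4)).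
  { apply (eq_is_derive (fun x => cosSeries (ipow 2) x + (PI * x / 2 - x ^ 2 / 4))); [|lra].
    intros t Ht. evar_last.
    - apply (is_derive_plus (K := R_AbsRing) (V := R_NormedModule)).
      + apply is_derive_cosSeries_2. lra.
      + auto_derive; [trivial|reflexivity].
    - unfold sawtooth, plus, zero; simpl. field. }
  rewrite cosSeries_PI3, cosSeries_PI in E. lra.
Qed.

Lemma harmonic_diff_bound (j m : nat) : harmonic (j + m) - harmonic j <= INR m * / INR (S j).
Proof.
  induction m as [|m IH].
  - rewrite Nat.add_0_r. simpl (INR 0). lra.
  - rewrite Nat.add_succ_r, harmonic_S, (S_INR m).
    assert (/ INR (S (j + m)) <= / INR (S j)).
    { apply Rinv_le_contravar; [apply lt_0_INR; lia|apply le_INR; lia]. }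
    lra.
Qed.

Lemma harmonic_0 : harmonic 0 = 0.
Proof. unfold harmonic. simpl. apply Rinv_0. Qed.

(** The sum over m <= K and N > K of 1 / (m^3 N (N - m)), which is lost when the partial fractions
    are summed over m < N <= K only. *)
Definition eulerError (K : nat) : R :=
  sum_f_R0 (fun m => ipow 4 m * (harmonic K - harmonic (K - m))) K.

(** Partial fractions of 1 / (m^3 N (N - m)) in N and m, together with the expansion of the product
    of the partial sums of 1/n^2 and 1/n^3. *)
Lemma euler_finite (K : nat) :
  sum_f_R0 (fun n => logSq n * ipow 3 n) K / 2 + sum_f_R0 (ipow 2) K * sum_f_R0 (ipow 3) K
  - 2 * sum_f_R0 (ipow 5) K = - eulerError K.
Proof.
  induction K as [|K IH].
  - unfold eulerError. simpl. rewrite logSq_0, !ipow_0. field.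
  - set (N := INR (S K)).
    assert (HN : N <> 0) by (apply not_0_INR; lia).
    assert (Herr : eulerError (S K) = eulerError K +
       sum_f_R0 (fun m => ipow 4 m * (/ N - / INR (S K - m))) K + ipow 4 (S K) * harmonic (S K)).
    { unfold eulerError. rewrite tech5, Nat.sub_diag, harmonic_0, Rminus_0_r. f_equal.
      rewrite <- plus_sum. apply sum_eq; intros m Hm.
      replace (S K - m)%nat with (S (K - m)) by lia. rewrite !harmonic_S. fold N. ring. }
    assert (Hpf : sum_f_R0 (fun m => ipow 4 m * (/ N - / INR (S K - m))) K =
       / N ^ 5 - (/ N ^ 4 * harmonic K + / N ^ 3 * sum_f_R0 (ipow 2) K
         + / N ^ 2 * sum_f_R0 (ipow 3) K + / N ^ 4 * (harmonic K + / N))).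
    { assert (Hrev : harmonic K + / N = sum_f_R0 (fun m => / INR (S K - m)) K).
      { pose proof (sum_f_R0_rev (fun k => / INR k) (S K)) as E.
        rewrite tech5, Nat.sub_diag in E. simpl (INR 0) in E. rewrite Rinv_0, Rplus_0_r in E.
        rewrite E. reflexivity. }
      rewrite Hrev. unfold harmonic.
      rewrite !scal_sum, <- !plus_sum.
      assert (Hd : forall x J, x = sum_f_R0 (fun m => if Nat.eq_dec m 0 then x else 0) J).
      { intros x J. induction J as [|J IHJ]; [reflexivity|].
        rewrite tech5, <- IHJ. destruct (Nat.eq_dec (S J) 0); [lia|ring]. }
      rewrite (Hd (/ N ^ 5) K), sum_f_R0_sub. apply sum_eq; intros m Hm.
      destruct (Nat.eq_dec m 0) as [->|H0].
      - rewrite !ipow_0, Nat.sub_0_r. simpl (INR 0). rewrite Rinv_0. fold N. field. exact HN.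
      - assert (HM : INR m <> 0) by (apply not_0_INR; lia).
        rewrite minus_INR by lia. fold N.
        assert (HNM : N - INR m <> 0).
        { unfold N. rewrite <- minus_INR by lia. apply not_0_INR; lia. }
        unfold ipow. field. auto. }
    rewrite Herr, Hpf, !tech5, logSq_harmonic, harmonic_S.
    unfold ipow in *. fold N.
    match type of IH with ?a / 2 + ?b * ?c - 2 * ?d = - ?e =>
      set (A := a) in *; set (B := b) in *; set (C := c) in *; set (D := d) in *; set (Er := e) in * end.
    replace Er with (- (A / 2 + B * C - 2 * D)) by lra. field. exact HN.
Qed.

(** H_K - H_(K-m) is at most m / (K - m + 1), and 1/(m (K + 1 - m)) is at most 2/(K + 1). *)
Lemma eulerError_bound (K : nat) : 0 <= eulerError K <= 2 * Series (ipow 2) * / INR (S K).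
Proof.
  assert (HK : 0 < INR (S K)) by (apply lt_0_INR; lia).
  assert (Hterm : forall m, (m <= K)%nat ->
    0 <= ipow 4 m * (harmonic K - harmonic (K - m)) <= ipow 2 m * (2 * / INR (S K))).
  { intros m Hm. destruct m as [|m]; [rewrite !ipow_0; lra|]. set (M := S m) in *.
    assert (HM : 1 <= INR M) by (unfold M; rewrite S_INR; pose proof (pos_INR m); lra).
    pose proof (harmonic_diff_bound (K - M) M) as Hb. replace (K - M + M)%nat with K in Hb by lia.
    assert (Hmono : harmonic (K - M) <= harmonic K).
    { unfold harmonic. destruct (le_lt_dec K (K - M)); [replace (K - M)%nat with K by lia; lra|].
      rewrite (tech2 (fun k => / INR k) (K - M) K) by lia.
      assert (0 <= sum_f_R0 (fun i => / INR (S (K - M) + i)) (K - S (K - M)))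
        by (apply cond_pos_sum; intros; apply Rinv_INR_bound). lra. }
    pose proof (ipow_bound 4 M).
    split; [apply Rmult_le_pos; lra|].
    apply Rle_trans with (ipow 4 M * (INR M * / INR (S (K - M)))).
    { apply Rmult_le_compat_l; lra. }
    set (p := INR M) in *. set (r := INR (S (K - M))).
    assert (Hr : 1 <= r) by (unfold r; rewrite S_INR; pose proof (pos_INR (K - M)); lra).
    assert (E : INR (S K) = p + r).
    { unfold p, r. rewrite <- plus_INR. f_equal. lia. }
    rewrite E. unfold ipow. fold p.
    apply Rminus_le_0.
    replace ((/ p) ^ 2 * (2 * / (p + r)) - (/ p) ^ 4 * (p * / r))
      with ((2 * p * r - (p + r)) * / (p ^ 3 * r * (p + r))) by (field; lra).
    apply Rmult_le_pos; [nra|]. left. apply Rinv_0_lt_compat.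
    apply Rmult_lt_0_compat; [apply Rmult_lt_0_compat; [apply pow_lt|]|]; lra. }
  unfold eulerError. split.
  - rewrite <- (sum_eq (fun m => if le_dec m K then ipow 4 m * (harmonic K - harmonic (K - m)) else 0)).
    + apply cond_pos_sum. intros m. destruct (le_dec m K); [apply Hterm; assumption|lra].
    + intros m Hm. destruct (le_dec m K); [reflexivity|lia].
  - eapply Rle_trans; [apply sum_Rle; intros m Hm; apply Hterm, Hm|].
    rewrite <- scal_sum.
    replace (2 * Series (ipow 2) * / INR (S K)) with (2 * / INR (S K) * Series (ipow 2)) by ring.
    apply Rmult_le_compat_l; [left; apply Rmult_lt_0_compat; [lra|apply Rinv_0_lt_compat, HK]|].
    rewrite (Series_incr_n (ipow 2) (S K)); [|lia|apply (ex_series_ipow 0)]. simpl pred.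
    assert (0 <= Series (fun k => ipow 2 (S K + k))); [|lra].
    eapply Rle_trans; [apply Rabs_pos|]. apply (Series_Rabs_le (fun _ => 0)).
    { intros n. rewrite Rabs_R0. apply ipow_bound. }
    apply -> (ex_series_incr_n (ipow 2) (S K)). apply (ex_series_ipow 0).
Qed.

(** The left-hand side is 2 zeta(4,1), by [logSq_harmonic]. *)
Lemma euler_zeta_4_1 :
  Series (fun n => logSq n * ipow 3 n) = 2 * (2 * zeta 5 - zeta 2 * zeta 3).
Proof.
  rewrite !zeta_ipow.
  assert (Hlim : forall a, ex_series a -> is_lim_seq (sum_f_R0 a) (Series a)).
  { intros a Ha. apply is_lim_seq_Reals. apply is_series_Reals, Series_correct, Ha. }
  pose proof (Hlim _ (ex_series_logSq 2)) as L1. pose proof (Hlim _ (ex_series_ipow 0)) as L2.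
  pose proof (Hlim _ (ex_series_ipow 1)) as L3. pose proof (Hlim _ (ex_series_ipow 3)) as L5.
  assert (LE : is_lim_seq eulerError 0).
  { apply is_lim_seq_le_le with (fun _ => 0) (fun K => 2 * Series (ipow 2) * / INR (S K)).
    - apply eulerError_bound.
    - apply is_lim_seq_const.
    - replace (Finite 0) with (Rbar_mult (2 * Series (ipow 2)) 0) by (simpl; f_equal; ring).
      apply is_lim_seq_scal_l.
      apply (is_lim_seq_incr_1 (fun n => / INR n)).
      replace (Finite 0) with (Rbar_inv p_infty) by reflexivity.
      apply is_lim_seq_inv; [apply is_lim_seq_INR|discriminate]. }
  apply is_lim_seq_opp in LE.
  pose proof (is_lim_seq_minus' _ _ _ _ (is_lim_seq_plus' _ _ _ _ (is_lim_seq_mult' _ _ _ _ L1 (is_lim_seq_const (/ 2)))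
    (is_lim_seq_mult' _ _ _ _ L2 L3)) (is_lim_seq_mult' _ _ _ _ (is_lim_seq_const 2) L5)) as L.
  apply (is_lim_seq_ext _ _ _ euler_finite) in L.
  apply is_lim_seq_unique in L. apply is_lim_seq_unique in LE. rewrite LE in L.
  injection L. lra.
Qed.

(** * Assembly *)

(** A primitive of the cubic x(pi - 3x)(2pi - 3x) times [logSin], by repeated integration by parts. *)
Definition logPrimitive (x : R) : R :=
  - (x * (PI - 3 * x) * (2 * PI - 3 * x)) * sinSeries (ipow 2) x
  - (2 * PI ^ 2 - 18 * PI * x + 27 * x ^ 2) * cosSeries (ipow 3) x
  + (54 * x - 18 * PI) * sinSeries (ipow 4) x
  + 54 * cosSeries (ipow 5) x.

Lemma is_derive_logPrimitive (x : R) : 0 < x < 2 * PI ->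
  is_derive logPrimitive x (x * (PI - 3 * x) * (2 * PI - 3 * x) * logSin x).
Proof.
  intros Hx.
  pose proof (is_derive_sinSeries_2 x Hx) as H2.
  assert (H3 : is_derive (cosSeries (ipow 3)) x (- sinSeries (ipow 2) x))
    by (apply is_derive_cosSeries; auto using ex_series_Rabs_ipow, INR_mul_ipow).
  assert (H4 : is_derive (sinSeries (ipow 4)) x (cosSeries (ipow 3) x))
    by (apply is_derive_sinSeries; auto using ex_series_Rabs_ipow, INR_mul_ipow).
  assert (H5 : is_derive (cosSeries (ipow 5)) x (- sinSeries (ipow 4) x))
    by (apply is_derive_cosSeries; auto using ex_series_Rabs_ipow, INR_mul_ipow).
  unfold logPrimitive.
  set (f2 := sinSeries (ipow 2)) in *. set (f3 := cosSeries (ipow 3)) in *.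
  set (f4 := sinSeries (ipow 4)) in *. set (f5 := cosSeries (ipow 5)) in *.
  auto_derive.
  - repeat split; eexists; eassumption.
  - assert (E2 : Derive (fun y : R => f2 y) x = _) by apply is_derive_unique, H2.
    assert (E3 : Derive (fun y : R => f3 y) x = _) by apply is_derive_unique, H3.
    assert (E4 : Derive (fun y : R => f4 y) x = _) by apply is_derive_unique, H4.
    assert (E5 : Derive (fun y : R => f5 y) x = _) by apply is_derive_unique, H5.
    rewrite E2, E3, E4, E5. ring.
Qed.

Lemma continuous_logPrimitive (x : R) : continuous logPrimitive x.
Proof.
  pose proof (continuous_sinSeries _ x (ex_series_Rabs_ipow 0)) as H2.
  pose proof (continuous_cosSeries _ x (ex_series_Rabs_ipow 1)) as H3.
  pose proof (continuous_sinSeries _ x (ex_series_Rabs_ipow 2)) as H4.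
  pose proof (continuous_cosSeries _ x (ex_series_Rabs_ipow 3)) as H5.
  assert (H3' : continuous (fun y => - cosSeries (ipow 3) y) x).
  { apply (continuous_opp (U := R_UniformSpace) (V := R_NormedModule) _ x H3). }
  apply (continuous_ext (fun x =>
    - (x * (PI - 3 * x) * (2 * PI - 3 * x)) * sinSeries (ipow 2) x
    + (2 * PI ^ 2 - 18 * PI * x + 27 * x ^ 2) * - cosSeries (ipow 3) x
    + (54 * x - 18 * PI) * sinSeries (ipow 4) x + 54 * cosSeries (ipow 5) x)).
  { intros y. unfold logPrimitive. change (@eq R_UniformSpace) with (@eq R). ring. }
  repeat apply continuous_Rplus; apply continuous_Rmult;
    try assumption; apply (ex_derive_continuous (V := R_NormedModule)); auto_derive; trivial.
Qed.

Lemma trigSeries_at_0 (f : R -> R) (a : nat -> R) : trigSeries f a 0 = Series a * f 0.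
Proof.
  unfold trigSeries. rewrite <- Series_scal_r. apply Series_ext; intros n. now rewrite Rmult_0_r.
Qed.

Lemma logPrimitive_increment :
  logPrimitive (PI / 3) - logPrimitive 0 = 7 / 3 * PI ^ 2 * zeta 3 - 29 * zeta 5.
Proof.
  unfold logPrimitive. rewrite !cosSeries_PI3, !trigSeries_at_0, sin_0, cos_0, !zeta_ipow. field.
Qed.

Lemma arcSeries_0 : arcSeries 0 = 4 * (2 * zeta 5 - zeta 2 * zeta 3).
Proof.
  unfold arcSeries. rewrite !trigSeries_at_0, sin_0, cos_0, euler_zeta_4_1. ring.
Qed.

(** A_3 and G with the corrections that integration by parts attaches to them: the first line
    differentiates to 2 x^2 L^2 L', the parenthesis to (pi/3 - x)^2 x^2 L' / 2, and the last line
    trades the remaining multiples of L' for multiples of L. *)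
Definition arcsinPart (x : R) : R :=
  cbSeries (ipow 3) x - 2 * logSin x * cbSeries (ipow 2) x + 2 * logSin x ^ 2 * cbSeries (ipow 1) x
  + (cbSeries strict_harmonic3 x + (PI / 3 - x) * cbSeries' strict_harmonic3 x
     + (PI / 3 - x) ^ 2 / 2 * cbSeries (ipow 1) x)
  - (2 * sawtooth x ^ 2 + (PI / 3 - x) ^ 2 / 2) * (x ^ 2 * logSin x).

(** In the derivative the terms with L^2 L' cancel against those of [circleSeries], those with L'
    alone against the last line of [arcsinPart], and the terms with L have the coefficient
    - (5/9) x (pi - 3x)(2 pi - 3x), which [logPrimitive] cancels. *)
Definition firstIntegral (x : R) : R :=
  arcsinPart x + 2 * circleSeries x - 2 * arcSeries x + 5 / 9 * logPrimitive x.

Lemma is_derive_arcsinPart (x : R) : 0 < x < PI / 2 ->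
  is_derive arcsinPart x
    (2 * x ^ 2 * logSin x ^ 2 * (sin x / chord2 x)
     - 2 * x ^ 2 * sawtooth x ^ 2 * (sin x / chord2 x)
     - (4 * x * sawtooth x ^ 2 - 2 * x ^ 2 * sawtooth x
        + x * (PI / 3 - x) * (PI / 3 - 2 * x)) * logSin x).
Proof.
  intros Hx. assert (Hc : 0 < cos x) by (apply cos_gt_0; lra).
  pose proof (is_derive_cbSeries_ipow 2 x Hx) as H3.
  pose proof (is_derive_cbSeries_ipow 1 x Hx) as H2.
  pose proof (is_derive_cbSeries_ipow 0 x Hx) as H1.
  rewrite cbSeries_ipow_0 in H1 by lra.
  pose proof (is_derive_cbSeries strict_harmonic3 x bounded_strict_harmonic3 Hc) as HG.
  pose proof (is_derive_cbSeries'_strict_harmonic3 x Hc) as HG'.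
  pose proof (is_derive_logSin x ltac:(lra)) as HL. pose proof (is_derive_sawtooth x) as HS.
  unfold arcsinPart.
  set (f1 := cbSeries (ipow 1)) in *. set (f2 := cbSeries (ipow 2)) in *.
  set (f3 := cbSeries (ipow 3)) in *. set (g := cbSeries strict_harmonic3) in *.
  set (g' := cbSeries' strict_harmonic3) in *. set (d := sin x / chord2 x) in *.
  auto_derive.
  - repeat split; eexists; eassumption.
  - assert (E1 : Derive (fun y : R => f1 y) x = _) by apply is_derive_unique, H1.
    assert (E2 : Derive (fun y : R => f2 y) x = _) by apply is_derive_unique, H2.
    assert (E3 : Derive (fun y : R => f3 y) x = _) by apply is_derive_unique, H3.
    assert (E4 : Derive (fun y : R => g y) x = _) by apply is_derive_unique, HG.
    assert (E5 : Derive (fun y : R => g' y) x = _) by apply is_derive_unique, HG'.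
    assert (EL : Derive (fun y : R => logSin y) x = _) by apply is_derive_unique, HL.
    assert (ES : Derive (fun y : R => sawtooth y) x = _) by apply is_derive_unique, HS.
    rewrite E1, E2, E3, E4, E5, EL, ES. field.
Qed.

Lemma is_derive_firstIntegral (x : R) : 0 < x < PI / 3 -> is_derive firstIntegral x 0.
Proof.
  intros Hx.
  pose proof (is_derive_arcsinPart x ltac:(lra)) as H1.
  pose proof (is_derive_circleSeries x Hx) as H2.
  pose proof (is_derive_arcSeries x ltac:(lra)) as H3.
  pose proof (is_derive_logPrimitive x ltac:(lra)) as H4.
  unfold firstIntegral. auto_derive.
  - repeat split; eexists; eassumption.
  - assert (E1 : Derive (fun y : R => arcsinPart y) x = _) by apply is_derive_unique, H1.
    assert (E2 : Derive (fun y : R => circleSeries y) x = _) by apply is_derive_unique, H2.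
    assert (E3 : Derive (fun y : R => arcSeries y) x = _) by apply is_derive_unique, H3.
    assert (E4 : Derive (fun y : R => logPrimitive y) x = _) by apply is_derive_unique, H4.
    rewrite E1, E2, E3, E4. unfold circleRe, sawtooth.
    set (d := sin x / chord2 x). field.
Qed.

Lemma constant_limits_eq (f : R -> R) (a b la lb : R) : a < b ->
  (forall x, a < x < b -> is_derive f x 0) ->
  filterlim f (at_right a) (locally la) -> filterlim f (at_left b) (locally lb) -> la = lb.
Proof.
  intros Hab Hd Ha Hb. set (c := (a + b) / 2).
  assert (Hc : forall x, a < x < b -> f c = f x).
  { intros x Hx. destruct (Rtotal_order c x) as [H|[->|H]].
    - apply eq_is_derive; [|exact H]. intros t Ht. apply Hd. unfold c in *; lra.
    - reflexivity.
    - symmetry. apply eq_is_derive; [|exact H]. intros t Ht. apply Hd. unfold c in *; lra. }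
  transitivity (f c).
  - apply (filterlim_locally_unique f _ _ Ha).
    apply filterlim_ext_loc with (fun _ => f c); [|apply filterlim_const].
    generalize (at_right_interval a b Hab). apply filter_imp, Hc.
  - apply (filterlim_locally_unique (F := at_left b) (fun _ => f c)).
    + apply filterlim_const.
    + apply filterlim_ext_loc with f; [|exact Hb].
      generalize (at_left_interval a b Hab). apply filter_imp. intros x Hx. symmetry. apply Hc, Hx.
Qed.

Lemma exp_2_logSin (x : R) : 0 < x < 2 * PI -> chord2 x = exp (logSin x) * exp (logSin x).
Proof.
  intros Hx. pose proof (one_minus_cos_pos x Hx). rewrite <- exp_plus. unfold logSin, chord2.
  replace (ln (2 - 2 * cos x) / 2 + ln (2 - 2 * cos x) / 2) with (ln (2 - 2 * cos x)) by field.
  rewrite exp_ln; lra.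
Qed.

(** The series vanish like t at 0, and so absorb powers of log t. *)
Lemma logSin_cbSeries_limit_0 (c : nat -> R) (k : nat) : (k <= 2)%nat ->
  bounded_seq (fun n => c n * ipow 2 n) ->
  filterlim (fun x => logSin x ^ k * cbSeries c x) (at_right 0) (locally 0).
Proof.
  intros Hk Hc. destruct (cbSeries_factor c Hc) as [d [Hd Hcd]]. pose proof PI_bounds.
  apply filterlim_ext with (fun x => logSin x ^ k * chord2 x * d x).
  { intros x. rewrite Hcd. ring. }
  replace (locally 0) with (locally (0 * d 0)) by now rewrite Rmult_0_l.
  apply filterlim_Rmult; [|apply filterlim_continuous_at_right, Hd].
  apply filterlim_squeeze_0 with (fun x => 4 * exp (logSin x)).
  - generalize (at_right_interval 0 (PI / 3) ltac:(lra)). apply filter_imp; intros x Hx.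
    pose proof (logSin_neg x Hx) as HL. rewrite exp_2_logSin by lra.
    set (L := logSin x) in *. pose proof (exp_pos L) as HE.
    assert (HE1 : exp L < 1) by (rewrite <- exp_0; apply exp_increasing, HL).
    assert (HX : exp L * (1 + L ^ 2) <= 4).
    { assert (E : exp L * (exp (- L / 2) * exp (- L / 2)) = 1).
      { rewrite <- !exp_plus. rewrite <- exp_0. f_equal. field. }
      pose proof (exp_ineq1_le (- L / 2)).
      assert ((1 - L / 2) * (1 - L / 2) <= exp (- L / 2) * exp (- L / 2)) by (apply Rmult_le_compat; lra).
      assert (1 + L ^ 2 <= 4 * (exp (- L / 2) * exp (- L / 2))) by nra.
      rewrite <- (Rmult_1_r 4), <- E. nra. }
    assert (HP : Rabs (L ^ k) <= 1 + L ^ 2).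
    { rewrite <- RPow_abs, <- (pow2_abs L). pose proof (Rabs_pos L).
      destruct k as [|[|[|k]]]; [| | |lia]; simpl; nra. }
    rewrite Rabs_mult, (Rabs_pos_eq (exp L * exp L)) by nra.
    apply Rle_trans with ((exp L * (1 + L ^ 2)) * exp L); [|nra].
    replace (exp L * (1 + L ^ 2) * exp L) with ((1 + L ^ 2) * (exp L * exp L)) by ring.
    apply Rmult_le_compat_r; [nra|exact HP].
  - replace 0 with (4 * 0) at 2 by ring.
    apply filterlim_Rmult; [apply filterlim_const|apply filterlim_exp_logSin_0].
Qed.

Lemma continuous_cbSeries (c : nat -> R) (x : R) :
  bounded_seq (fun n => c n * ipow 2 n) -> 0 < cos x -> continuous (cbSeries c) x.
Proof.
  intros Hc Hx. apply (ex_derive_continuous (cbSeries c)). eexists.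
  now apply is_derive_cbSeries.
Qed.

Lemma arcsinPart_limit_0 : filterlim arcsinPart (at_right 0) (locally 0).
Proof.
  assert (Hc : 0 < cos 0) by (rewrite cos_0; lra). pose proof PI_bounds.
  pose proof (fun k j Hk => logSin_cbSeries_limit_0 (ipow j) k Hk (bounded_ipow j)) as HL.
  assert (HG : filterlim (cbSeries strict_harmonic3) (at_right 0) (locally 0)).
  { rewrite <- (cbSeries_at_0 strict_harmonic3) at 2.
    apply filterlim_continuous_at_right, continuous_cbSeries; [apply bounded_strict_harmonic3|exact Hc]. }
  assert (HG' : filterlim (cbSeries' strict_harmonic3) (at_right 0) (locally 0)).
  { assert (E : cbSeries' strict_harmonic3 0 = 0) by (unfold cbSeries'; rewrite sin_0; ring).
    rewrite <- E at 2.
    apply filterlim_continuous_at_right, (ex_derive_continuous (cbSeries' strict_harmonic3)).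
    eexists. apply is_derive_cbSeries'_strict_harmonic3, Hc. }
  assert (Hp : forall p : R -> R, ex_derive p 0 -> filterlim p (at_right 0) (locally (p 0))).
  { intros p Hd. apply filterlim_continuous_at_right, (ex_derive_continuous p), Hd. }
  apply filterlim_ext_loc with (fun x =>
     logSin x ^ 0 * cbSeries (ipow 3) x + (-2) * (logSin x ^ 1 * cbSeries (ipow 2) x)
     + 2 * (logSin x ^ 2 * cbSeries (ipow 1) x)
     + (cbSeries strict_harmonic3 x + (PI / 3 - x) * cbSeries' strict_harmonic3 x
        + (PI / 3 - x) ^ 2 / 2 * (logSin x ^ 0 * cbSeries (ipow 1) x))
     - (2 * sawtooth x ^ 2 + (PI / 3 - x) ^ 2 / 2) * (2 * (logSin x ^ 1 * cbSeries (ipow 0) x))).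
  { generalize (at_right_interval 0 (PI / 2) ltac:(lra)). apply filter_imp; intros x Hx.
    unfold arcsinPart. rewrite cbSeries_ipow_0 by lra. field. }
  assert (HK : forall v : R, filterlim (fun _ : R => v) (at_right 0) (locally v))
    by (intros; apply filterlim_const).
  pose proof (Hp (fun x => PI / 3 - x) ltac:(auto_derive; trivial)) as H1.
  pose proof (Hp (fun x => (PI / 3 - x) ^ 2 / 2) ltac:(auto_derive; trivial)) as H2.
  pose proof (Hp (fun x => 2 * sawtooth x ^ 2 + (PI / 3 - x) ^ 2 / 2)
    ltac:(unfold sawtooth; auto_derive; trivial)) as H3.
  cbv beta in H1, H2, H3.
  replace (locally 0) with (locally (0 + (-2) * 0 + 2 * 0
    + (0 + (PI / 3 - 0) * 0 + (PI / 3 - 0) ^ 2 / 2 * 0)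
    - (2 * sawtooth 0 ^ 2 + (PI / 3 - 0) ^ 2 / 2) * (2 * 0))).
  2: { rewrite !Rmult_0_r, !Rplus_0_r, Rminus_0_r. reflexivity. }
  apply filterlim_Rminus;
    [apply filterlim_Rplus;
      [apply filterlim_Rplus; [apply filterlim_Rplus|]
      |apply filterlim_Rplus; [apply filterlim_Rplus; [exact HG|]|]]|].
  - apply (HL 0%nat 3%nat). lia.
  - apply filterlim_Rmult; [apply HK|apply (HL 1%nat 2%nat); lia].
  - apply filterlim_Rmult; [apply HK|apply (HL 2%nat 1%nat); lia].
  - apply filterlim_Rmult; [exact H1|exact HG'].
  - apply filterlim_Rmult; [exact H2|apply (HL 0%nat 1%nat); lia].
  - apply filterlim_Rmult; [exact H3|].
    apply filterlim_Rmult; [apply HK|apply (HL 1%nat 0%nat); lia].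
Qed.

Lemma sum_n_m_strict_harmonic3 (k : nat) :
  sum_n_m (fun j => 1 / INR j ^ 3) 1 (S k) = strict_harmonic3 (S k) + ipow 3 (S k).
Proof.
  assert (E : forall j, 1 / INR j ^ 3 = ipow 3 j).
  { intros j. unfold ipow. rewrite pow_inv. unfold Rdiv. ring. }
  unfold strict_harmonic3. simpl pred.
  induction k as [|k IH].
  - rewrite sum_n_n, E. simpl sum_f_R0. rewrite ipow_0.
    symmetry. apply Rplus_0_l.
  - rewrite sum_n_Sm, IH, E by lia. reflexivity.
Qed.

Lemma is_series_cbSeries_PI3 (c : nat -> R) :
  bounded_seq (fun n => c n * ipow 2 n) -> is_series (cbcoef c) (cbSeries c (PI / 3)).
Proof.
  intros Hc. unfold cbSeries, chord2. rewrite cos_PI3. replace (2 - 2 * (1 / 2)) with 1 by field.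
  assert (H : ex_pseries (cbcoef c) 1).
  { apply CV_radius_inside. replace 1 with (chord2 (PI / 3)) by (unfold chord2; rewrite cos_PI3; field).
    apply CV_radius_cbcoef; [exact Hc|rewrite cos_PI3; lra]. }
  apply ex_pseries_R in H. apply Series_correct in H.
  revert H. apply is_series_ext. intros n. rewrite pow1. apply Rmult_1_r.
Qed.

(* Stdlib world (Coquelicot). [is_series] asserts convergence together with the value. *)
Theorem mainTheorem3 :
  is_series
    (fun k : nat =>
       let i := S k in
       sum_n_m (fun j : nat => 1 / INR j ^ 3) 1 i
         / (INR i ^ 2 * central_binomial i))
    (zeta 5 / 9 + PI ^ 2 * zeta 3 / 27).
Proof.
  pose proof PI_bounds as HPI.
  assert (Hc : 0 < cos (PI / 3)) by (rewrite cos_PI3; lra).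
  assert (E : 0 + 2 * 0 - 2 * arcSeries 0 + 5 / 9 * logPrimitive 0 =
     arcsinPart (PI / 3) + 2 * arcSeries (PI / 3) - 2 * arcSeries (PI / 3) + 5 / 9 * logPrimitive (PI / 3)).
  { apply (constant_limits_eq firstIntegral 0 (PI / 3)); [lra|apply is_derive_firstIntegral| |].
    - unfold firstIntegral.
      apply filterlim_Rplus; [apply filterlim_Rminus; [apply filterlim_Rplus|]|].
      + apply arcsinPart_limit_0.
      + apply filterlim_Rmult; [apply filterlim_const|apply circleSeries_limit_0].
      + apply filterlim_Rmult; [apply filterlim_const|].
        apply filterlim_continuous_at_right, continuous_arcSeries.
      + apply filterlim_Rmult; [apply filterlim_const|].
        apply filterlim_continuous_at_right, continuous_logPrimitive.
    - unfold firstIntegral.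
      apply filterlim_Rplus; [apply filterlim_Rminus; [apply filterlim_Rplus|]|].
      + apply filterlim_continuous_at_left, (ex_derive_continuous arcsinPart).
        eexists. apply is_derive_arcsinPart. lra.
      + apply filterlim_Rmult; [apply filterlim_const|apply circleSeries_limit_PI3].
      + apply filterlim_Rmult; [apply filterlim_const|].
        apply filterlim_continuous_at_left, continuous_arcSeries.
      + apply filterlim_Rmult; [apply filterlim_const|].
        apply filterlim_continuous_at_left, continuous_logPrimitive. }
  rewrite arcSeries_0 in E. pose proof logPrimitive_increment as EP.
  assert (ES : arcsinPart (PI / 3) = cbSeries (ipow 3) (PI / 3) + cbSeries strict_harmonic3 (PI / 3)).
  { unfold arcsinPart. rewrite logSin_PI3. field. }
  replace (zeta 5 / 9 + PI ^ 2 * zeta 3 / 27)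
    with (cbSeries strict_harmonic3 (PI / 3) + cbSeries (ipow 3) (PI / 3)).
  2: { rewrite zeta_2 in E. lra. }
  pose proof (is_series_plus _ _ _ _ (is_series_cbSeries_PI3 _ bounded_strict_harmonic3)
    (is_series_cbSeries_PI3 _ (bounded_ipow 3))) as HS.
  apply (is_series_ext (fun k => cbcoef strict_harmonic3 (S k) + cbcoef (ipow 3) (S k))).
  { intros k. cbv zeta. rewrite sum_n_m_strict_harmonic3. unfold cbcoef, cbinv, Rdiv.
    assert (E2 : / INR (S k) ^ 2 = ipow 2 (S k)) by (unfold ipow; now rewrite pow_inv).
    rewrite Rinv_mult, E2.
    match goal with |- ?a = ?b => change (a = b :> R) end. ring. }
  apply (is_series_incr_1 (K := R_AbsRing) (V := R_NormedModule) (fun n => cbcoef strict_harmonic3 n + cbcoef (ipow 3) n)).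
  replace (plus _ _) with (cbSeries strict_harmonic3 (PI / 3) + cbSeries (ipow 3) (PI / 3)); [exact HS|].
  unfold cbcoef, plus; simpl. rewrite !ipow_0. ring.
Qed.
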